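(* Let $\Bbbk$ be a field, let $\alpha\in\Bbbk^\times$, and let $B=B_K(\alpha)$ be the connected graded $\Bbbk$-algebra generated by the degree-one elements $x_1,x_2,y_1,y_2$ subject to the relations $$x_2x_1=-x_1x_2,\quad y_2y_1=-y_1y_2,\quad y_1x_1=x_1y_1,\quad y_1x_2=x_2y_2,\quad y_2x_1=x_1y_2,\quad y_2x_2=\alpha x_2y_1.$$ Let $M_y=B/(y_1,y_2)B$, where $(y_1,y_2)B=y_1B+y_2B$. Then the sequence $$0\longrightarrow B(-2)\xrightarrow{d_2^{(y)}}B(-1)^2\xrightarrow{d_1^{(y)}}B\longrightarrow M_y\longrightarrow 0,$$ where $$d_1^{(y)}(u,v)=uy_1+vy_2,\qquad d_2^{(y)}(w)=(wy_2,\;wy_1),$$ is a minimal graded free resolution of $M_y$. In particular, $$\beta_{0,0}^B(M_y)=1,\quad \beta_{1,1}^B(M_y)=2,\quad \beta_{2,2}^B(M_y)=1,$$ and all other graded Betti numbers of $M_y$ vanish.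
   Context: All modules are finitely generated graded right $B$-modules. $B=\bigoplus_{n\ge0}B_n$ is graded with $x_1,x_2,y_1,y_2$ in degree $1$, and $B_{\ge1}=\bigoplus_{n\ge1}B_n$. $B(-j)$ denotes the degree shift of $B$, the free right module of rank one with generator in degree $j$. A graded free resolution of a graded right $B$-module $M$ is an exact complex $\cdots\to F_1\xrightarrow{d_1}F_0\to M\to0$ with each $F_i$ a graded free right $B$-module; it is minimal if $d_i(F_i)\subseteq F_{i-1}B_{\ge1}$ for all $i\ge1$. The graded Betti numbers are $\beta_{i,j}^B(M)=\dim_\Bbbk\operatorname{Tor}_i^B(M,\Bbbk)_j$; equivalently, in the minimal graded free resolution $F_i\cong\bigoplus_j B(-j)^{\beta_{i,j}^B(M)}$.
   Formalization: The displayed maps are not right linear; it is proved that they resolve B/(By_1+By_2) as left modules, with y_1B+y_2B=By_1+By_2, and that the right module M_y is resolved by d_1(u,v)=y_1u+y_2v, d_2(w)=(y_2w,y_1w), with the stated Betti numbers in both cases. *)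

(* Defs.v *)
From HB Require Import structures.
From mathcomp Require Import all_boot all_algebra.
From mathcomp Require Import boolp monalg.

Set Implicit Arguments.
Unset Strict Implicit.
Unset Printing Implicit Defensive.

Import GRing.Theory.
Local Open Scope ring_scope.
Local Open Scope quotient_scope.

Section QuotientModule.
Variables (A : nzRingType) (V : lmodType A).

Record submodule := Submodule {
  in_submodule :> V -> Prop;
  submodule0 : in_submodule 0;
  submoduleP : forall a u v,
    in_submodule u -> in_submodule v -> in_submodule (a *: u + v) }.

Variable S : submodule.
Definition submodule_pred : {pred V} := fun v => `[< S v >].

Fact submodule_pred_closed : zmod_closed submodule_pred.
Proof.
split; first by apply/asboolP; exact: submodule0.
move=> u v /asboolP Su /asboolP Sv; apply/asboolP.
by rewrite addrC -scaleN1r; exact: submoduleP.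
Qed.
HB.instance Definition _ :=
  GRing.isZmodClosed.Build V submodule_pred submodule_pred_closed.

Definition quotmod := Quotient.quot submodule_pred.
HB.instance Definition _ := Choice.on quotmod.
HB.instance Definition _ := GRing.Zmodule.on quotmod.

Definition quotmod_pi : V -> quotmod :=
  locked (fun v => \pi_(Quotient.quot submodule_pred) v).

Fact quotmod_piE u v : quotmod_pi u = quotmod_pi v <-> S (u - v).
Proof.
rewrite /quotmod_pi -lock; split=> [/eqP|Suv].
  by rewrite -Quotient.idealrBE => /asboolP.
by apply/eqP; rewrite -Quotient.idealrBE; apply/asboolP.
Qed.

Fact quotmod_piD u v : quotmod_pi (u + v) = quotmod_pi u + quotmod_pi v.
Proof. by rewrite /quotmod_pi -lock Quotient.pi_add. Qed.

Fact quotmod_reprK (x : quotmod) : quotmod_pi (repr x) = x.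
Proof. by rewrite /quotmod_pi -lock; exact: reprK. Qed.

Definition quotmod_scale : A -> quotmod -> quotmod :=
  locked (fun a x => quotmod_pi (a *: repr x)).

Fact quotmod_piZ a v : quotmod_pi (a *: v) = quotmod_scale a (quotmod_pi v).
Proof.
rewrite /quotmod_scale -lock; apply/quotmod_piE; rewrite -scalerBr -[_ *: _]addr0.
apply: submoduleP; last exact: submodule0.
by apply/quotmod_piE; rewrite quotmod_reprK.
Qed.

Fact quotmod_scalerA a b x :
  quotmod_scale a (quotmod_scale b x) = quotmod_scale (a * b) x.
Proof. by rewrite -[x]quotmod_reprK -!quotmod_piZ scalerA. Qed.
Fact quotmod_scale1r : left_id 1 quotmod_scale.
Proof. by move=> x; rewrite -[x]quotmod_reprK -!quotmod_piZ scale1r. Qed.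
Fact quotmod_scalerDr : right_distributive quotmod_scale +%R.
Proof.
move=> a x y; rewrite -[x]quotmod_reprK -[y]quotmod_reprK.
by rewrite -quotmod_piD -!quotmod_piZ -quotmod_piD scalerDr.
Qed.
Fact quotmod_scalerDl x : {morph quotmod_scale^~ x : a b / a + b}.
Proof.
move=> a b; rewrite -[x]quotmod_reprK -!quotmod_piZ scalerDl.
exact: quotmod_piD.
Qed.
HB.instance Definition _ := GRing.Zmodule_isLmodule.Build A quotmod
  quotmod_scalerA quotmod_scale1r quotmod_scalerDr quotmod_scalerDl.
End QuotientModule.

Section QuotientAlgebra.
Variables (K : fieldType) (R : algType K) (rels : seq R).

Definition in_relideal (x : R) : Prop :=
  exists2 s : seq (R * R * R),
    all (fun t => t.1.2 \in rels) s & x = \sum_(t <- s) t.1.1 * t.1.2 * t.2.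

Definition relideal : {pred R} := fun x => `[< in_relideal x >].

Fact relideal_closed : zmod_closed relideal.
Proof.
split; first by apply/asboolP; exists [::]; rewrite ?big_nil.
move=> x y /asboolP[s Rs ->] /asboolP[t Rt ->]; apply/asboolP.
exists (s ++ [seq ((- u.1.1, u.1.2), u.2) | u <- t]).
  by rewrite all_cat Rs all_map.
rewrite big_cat big_map /= -sumrN; congr (_ + _).
by apply: eq_bigr => u _; rewrite !mulNr.
Qed.
HB.instance Definition _ := GRing.isZmodClosed.Build R relideal relideal_closed.

Fact relidealM l x m : x \in relideal -> l * x * m \in relideal.
Proof.
move=> /asboolP[s Rs ->]; apply/asboolP.
exists [seq ((l * u.1.1, u.1.2), u.2 * m) | u <- s]; first by rewrite all_map.
rewrite big_map mulr_sumr mulr_suml.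
by apply: eq_bigr => u _; rewrite !mulrA.
Qed.

Fact relideal_gen r : r \in rels -> r \in relideal.
Proof.
move=> Rr; apply/asboolP; exists [:: ((1, r), 1)]; first by rewrite /= Rr.
by rewrite big_seq1 mul1r mulr1.
Qed.

Definition quotalg (proper : 1 \notin relideal) : Type := Quotient.quot relideal.

Hypothesis proper : 1 \notin relideal.
Local Notation Q := (quotalg proper).
HB.instance Definition _ := Choice.on Q.
HB.instance Definition _ := GRing.Zmodule.on Q.

Definition quotalg_pi : R -> Q :=
  locked (fun x => \pi_(Quotient.quot relideal) x).
Local Notation piQ := quotalg_pi.

Fact quotalg_piE x y : piQ x = piQ y <-> x - y \in relideal.
Proof.
rewrite /piQ -lock; split=> [/eqP|xy]; first by rewrite Quotient.idealrBE.
by apply/eqP; rewrite -Quotient.idealrBE.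
Qed.
Fact quotalg_piD x y : piQ (x + y) = piQ x + piQ y.
Proof. by rewrite /piQ -lock Quotient.pi_add. Qed.
Fact quotalg_reprK (x : Q) : piQ (repr x) = x.
Proof. by rewrite /piQ -lock; exact: reprK. Qed.

Definition quotalg_mul : Q -> Q -> Q :=
  locked (fun x y => piQ (repr x * repr y)).
Definition quotalg_scale : K -> Q -> Q :=
  locked (fun c x => piQ (c *: repr x)).

Fact quotalg_piM x y : piQ (x * y) = quotalg_mul (piQ x) (piQ y).
Proof.
rewrite /quotalg_mul -lock; apply/quotalg_piE; set x' := repr (piQ x); set y' := repr (piQ y).
have -> : x * y - x' * y' = 1 * (x - x') * y + x' * (y - y') * 1.
  by rewrite mul1r mulr1 mulrBl mulrBr addrA subrK.
by apply: rpredD; apply/relidealM/quotalg_piE; rewrite quotalg_reprK.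
Qed.

Fact quotalg_piZ c x : piQ (c *: x) = quotalg_scale c (piQ x).
Proof.
rewrite /quotalg_scale -lock; apply/quotalg_piE; rewrite -scalerBr -mulr_algl -[_ * _]mulr1.
by apply/relidealM/quotalg_piE; rewrite quotalg_reprK.
Qed.

Fact quotalg_mulA : associative quotalg_mul.
Proof.
move=> x y z; rewrite -[x]quotalg_reprK -[y]quotalg_reprK -[z]quotalg_reprK.
by rewrite -!quotalg_piM mulrA.
Qed.
Fact quotalg_mul1r : left_id (piQ 1) quotalg_mul.
Proof. by move=> x; rewrite -[x]quotalg_reprK -!quotalg_piM mul1r. Qed.
Fact quotalg_mulr1 : right_id (piQ 1) quotalg_mul.
Proof. by move=> x; rewrite -[x]quotalg_reprK -!quotalg_piM mulr1. Qed.
Fact quotalg_mulDl : left_distributive quotalg_mul +%R.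
Proof.
move=> x y z; rewrite -[x]quotalg_reprK -[y]quotalg_reprK -[z]quotalg_reprK.
by rewrite -quotalg_piD -!quotalg_piM -quotalg_piD mulrDl.
Qed.
Fact quotalg_mulDr : right_distributive quotalg_mul +%R.
Proof.
move=> x y z; rewrite -[x]quotalg_reprK -[y]quotalg_reprK -[z]quotalg_reprK.
by rewrite -quotalg_piD -!quotalg_piM -quotalg_piD mulrDr.
Qed.
Fact quotalg_1neq0 : piQ 1 != 0.
Proof.
apply/eqP; have -> : (0 : Q) = piQ 0 by apply: (addrI (piQ 0)); rewrite -quotalg_piD !addr0.
by move/quotalg_piE; rewrite subr0; apply/negP.
Qed.
HB.instance Definition _ := GRing.Zmodule_isNzRing.Build Q quotalg_mulA
  quotalg_mul1r quotalg_mulr1 quotalg_mulDl quotalg_mulDr quotalg_1neq0.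

Fact quotalg_scalerA a b x :
  quotalg_scale a (quotalg_scale b x) = quotalg_scale (a * b) x.
Proof. by rewrite -[x]quotalg_reprK -!quotalg_piZ scalerA. Qed.
Fact quotalg_scale1r : left_id 1 quotalg_scale.
Proof. by move=> x; rewrite -[x]quotalg_reprK -!quotalg_piZ scale1r. Qed.
Fact quotalg_scalerDr : right_distributive quotalg_scale +%R.
Proof.
move=> a x y; rewrite -[x]quotalg_reprK -[y]quotalg_reprK.
by rewrite -quotalg_piD -!quotalg_piZ -quotalg_piD scalerDr.
Qed.
Fact quotalg_scalerDl x : {morph quotalg_scale^~ x : a b / a + b}.
Proof.
move=> a b; rewrite -[x]quotalg_reprK -!quotalg_piZ scalerDl.
exact: quotalg_piD.
Qed.
HB.instance Definition _ := GRing.Zmodule_isLmodule.Build K Q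
  quotalg_scalerA quotalg_scale1r quotalg_scalerDr quotalg_scalerDl.

Fact quotalg_scalerAl (c : K) (x y : Q) : c *: (x * y) = (c *: x) * y.
Proof.
rewrite -[x]quotalg_reprK -[y]quotalg_reprK.
have := quotalg_piM (c *: repr x) (repr y).
by rewrite -scalerAl !quotalg_piZ quotalg_piM.
Qed.
HB.instance Definition _ :=
  GRing.Lmodule_isLalgebra.Build K Q quotalg_scalerAl.
Fact quotalg_scalerAr (c : K) (x y : Q) : c *: (x * y) = x * (c *: y).
Proof.
rewrite -[x]quotalg_reprK -[y]quotalg_reprK.
have := quotalg_piM (repr x) (c *: repr y).
by rewrite -scalerAr !quotalg_piZ quotalg_piM.
Qed.
HB.instance Definition _ :=
  GRing.Lalgebra_isAlgebra.Build K Q quotalg_scalerAr.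
End QuotientAlgebra.

(* The quotient of R by the two-sided ideal generated by [rels]. It is used only
   through this interface: an opaque construction keeps unification from
   unfolding the ring operations of the quotient. *)
Record quotient_algebra (K : fieldType) (R : algType K) (rels : seq R) :=
  QuotientAlgebra {
    qalg :> algType K;
    qalg_pi : {lrmorphism R -> qalg};
    qalg_pi_surj : forall a, exists x, qalg_pi x = a;
    qalg_pi_eq0 : forall x, qalg_pi x = 0 <-> in_relideal rels x }.

Fact quotient_algebraP (K : fieldType) (R : algType K) (rels : seq R) :
  1 \notin relideal rels -> quotient_algebra rels.
Proof.
move=> proper; pose p := quotalg_pi proper.
have pB : zmod_morphism p.
  move=> x y; apply/eqP; rewrite eq_sym subr_eq -quotalg_piD; apply/eqP.
  by rewrite subrK.
have pM : monoid_morphism p by split=> [//|x y]; exact: quotalg_piM.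
have pZ : scalable p by move=> c x; exact: quotalg_piZ.
pose mB := GRing.isZmodMorphism.Build _ _ p pB.
pose mM := GRing.isMonoidMorphism.Build _ _ p pM.
pose mZ := GRing.isScalable.Build _ _ _ _ p pZ.
pose pl : {lrmorphism R -> quotalg proper} := HB.pack p mB mM mZ.
apply: (@QuotientAlgebra K R rels (quotalg proper) pl) => [a|x].
  by exists (repr a); exact: quotalg_reprK.
have -> : (0 : quotalg proper) = p 0.
  by apply: (addrI (p 0)); rewrite -quotalg_piD !addr0.
split=> [/quotalg_piE|x0]; first by rewrite subr0 => /asboolP.
by apply/quotalg_piE; rewrite subr0; apply/asboolP.
Qed.

Definition BK_relators (K : fieldType) (alpha : K) (R : algType K)
    (x1 x2 y1 y2 : R) : seq R :=
  [:: x2 * x1 + x1 * x2; y2 * y1 + y1 * y2;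
      y1 * x1 - x1 * y1; y1 * x2 - x2 * y2;
      y2 * x1 - x1 * y2; y2 * x2 - alpha *: (x2 * y1)].

Fact BK_relators_proper (K : fieldType) (alpha : K) (R : algType K)
    (x1 x2 y1 y2 : R) (e : {rmorphism R -> K}) :
  e x1 = 0 -> e x2 = 0 -> e y1 = 0 -> e y2 = 0 ->
  1 \notin relideal (BK_relators alpha x1 x2 y1 y2).
Proof.
move=> ex1 ex2 ey1 ey2; apply/negP => /asboolP[s Rs] /(congr1 e)/eqP.
rewrite rmorph1 rmorph_sum big_seq big1 ?oner_eq0 // => u /(allP Rs).
rewrite !rmorphM; suff rel0 r : r \in BK_relators alpha x1 x2 y1 y2 -> e r = 0.
  by move=> /rel0 ->; rewrite mulr0 mul0r.
rewrite !in_cons in_nil orbF => /or4P[|||/or3P[]] /eqP ->.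
- by rewrite rmorphD !rmorphM ex1 ex2 mulr0 addr0.
- by rewrite rmorphD !rmorphM ey1 ey2 mulr0 addr0.
- by rewrite rmorphB !rmorphM ex1 ey1 mulr0 subr0.
- by rewrite rmorphB !rmorphM ex2 ey2 mul0r mulr0 subr0.
- by rewrite rmorphB !rmorphM ex1 ey2 mul0r subr0.
- by rewrite -mulr_algl rmorphB !rmorphM ex2 ey2 mulr0 mul0r mulr0 subr0.
Qed.

Section BKRelations.
Variables (K : fieldType) (alpha : K) (R : algType K) (X1 X2 Y1 Y2 : R).
Variable Q : quotient_algebra (BK_relators alpha X1 X2 Y1 Y2).
Local Notation pi := (qalg_pi Q).

Fact BK_relations_pi :
  [/\ pi X2 * pi X1 = - (pi X1 * pi X2), pi Y2 * pi Y1 = - (pi Y1 * pi Y2)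
    & [/\ pi Y1 * pi X1 = pi X1 * pi Y1, pi Y1 * pi X2 = pi X2 * pi Y2,
          pi Y2 * pi X1 = pi X1 * pi Y2
        & pi Y2 * pi X2 = alpha *: (pi X2 * pi Y1)]].
Proof.
have pi0 r : r \in BK_relators alpha X1 X2 Y1 Y2 -> pi r = 0.
  by move=> Rr; apply/qalg_pi_eq0/asboolP; exact: relideal_gen.
have pi_eq x y : x - y \in BK_relators alpha X1 X2 Y1 Y2 -> pi x = pi y.
  by move/pi0/eqP; rewrite rmorphB subr_eq0 => /eqP.
have pi_opp x y : x + y \in BK_relators alpha X1 X2 Y1 Y2 -> pi x = - pi y.
  by move/pi0/eqP; rewrite rmorphD addr_eq0 => /eqP.
split; last split; rewrite -!rmorphM -?linearZ /=.
- by apply: pi_opp; rewrite mem_head.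
- by apply: pi_opp; rewrite !in_cons eqxx !orbT.
- by apply: pi_eq; rewrite !in_cons eqxx !orbT.
- by apply: pi_eq; rewrite !in_cons eqxx !orbT.
- by apply: pi_eq; rewrite !in_cons eqxx !orbT.
- by apply: pi_eq; rewrite !in_cons eqxx !orbT.
Qed.
End BKRelations.

(* The free algebra K<x1,x2,y1,y2>, as the algebra of the free monoid on 'I_4;
   the letters 0, 1, 2, 3 are x1, x2, y1, y2. *)
Section AlgebraB.
Variables (K : fieldType) (alpha : K).

Definition freealg : Type := {malg K[{fmonom 'I_4}]}.
HB.instance Definition _ := GRing.Lalgebra.on freealg.

Fact freealg_scalerAr (k : K) (x y : freealg) : k *: (x * y) = x * (k *: y).
Proof.
rewrite -!mul_malgC mulrA [RHS]mulrA; congr (_ * y).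
rewrite !malgM_def fgmulUg fgmulgU.
by apply: eq_bigr => m _; rewrite mul1m mulm1 mulrC.
Qed.
HB.instance Definition _ :=
  GRing.Lalgebra_isAlgebra.Build K freealg freealg_scalerAr.

Definition letter (i : 'I_4) : freealg := << fmu i >>.

Fact relators_proper : 1 \notin
  relideal (BK_relators alpha (letter (inord 0)) (letter (inord 1))
                              (letter (inord 2)) (letter (inord 3))).
Proof.
pose e : {rmorphism freealg -> K} := @mcoeff {fmonom 'I_4} K mone.
have letter0 i : e (letter i) = 0.
  by rewrite /e /= mcoeffU1 -[_ == _]val_eqE /= fmU fm1.
exact: (@BK_relators_proper K alpha freealg _ _ _ _ e).
Qed.

Definition BKquotient := quotient_algebraP relators_proper.
Definition BK : algType K := BKquotient.

Definition BKgen (i : 'I_4) : BK := qalg_pi BKquotient (letter i).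
Definition x1 := BKgen (inord 0).
Definition x2 := BKgen (inord 1).
Definition y1 := BKgen (inord 2).
Definition y2 := BKgen (inord 3).

Fact BK_relations :
  [/\ x2 * x1 = - (x1 * x2), y2 * y1 = - (y1 * y2)
    & [/\ y1 * x1 = x1 * y1, y1 * x2 = x2 * y2, y2 * x1 = x1 * y2
        & y2 * x2 = alpha *: (x2 * y1)]].
Proof. exact: BK_relations_pi. Qed.

(* B_n is spanned by the words of length n in the generators. *)
Definition BKdeg (n : int) (b : BK) : Prop :=
  match n with
  | Posz m => exists c : m.-tuple 'I_4 -> K,
      b = \sum_(w : m.-tuple 'I_4) c w *: \prod_(i <- w) BKgen i
  | Negz _ => b = 0
  end.
End AlgebraB.

(* Graded left modules over a connected graded K-algebra A. The structure map
   of A is [iota : K -> A], and a grading is given by its predicates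
   "homogeneous of degree j". Right modules over A are left modules over the
   converse ring [A^c], whose action [b *: m] is the product m.b; this is why
   [iota] and [deg] are parameters and not derived from an algebra structure. *)
Section GradedModules.
Variables (K : fieldType) (A : nzRingType).
Variables (iota : K -> A) (deg : int -> A -> Prop).

Definition grading (V : Type) := int -> V -> Prop.

(* F is isomorphic to a finite direct sum of shifts A(-a_s). *)
Definition graded_free (F : lmodType A) (degF : grading F) : Prop :=
  exists (n : nat) (a : 'I_n -> int) (b : 'I_n -> F),
    (forall x, exists! c : {ffun 'I_n -> A}, x = \sum_s c s *: b s) /\
    (forall j (c : {ffun 'I_n -> A}),
       degF j (\sum_s c s *: b s) <-> forall s, deg (j - a s) (c s)).

Definition preserves_degree (U V : Type) (degU : grading U) (degV : grading V)
    (f : U -> V) : Prop :=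
  forall j x, degU j x -> degV j (f x).

(* A_{>=1}, and the submodule A_{>=1} F of F. *)
Definition in_Apos (a : A) : Prop :=
  exists n (c : 'I_n -> A),
    (forall k : 'I_n, deg (Posz k.+1) (c k)) /\ a = \sum_(k < n) c k.

Definition in_AposM (F : lmodType A) (x : F) : Prop :=
  exists n (a : 'I_n -> A) (f : 'I_n -> F),
    (forall k, in_Apos (a k)) /\ x = \sum_(k < n) a k *: f k.

Record graded_free_resolution (M : lmodType A) (degM : grading M)
    (F : nat -> lmodType A) (degF : forall i, grading (F i))
    (d : forall i, F i.+1 -> F i) (aug : F 0%N -> M) : Prop := {
  gfr_free : forall i, graded_free (@degF i);
  gfr_d_linear : forall i, linear (d i);
  gfr_aug_linear : linear aug;
  gfr_d_degree : forall i, preserves_degree (@degF i.+1) (@degF i) (d i);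
  gfr_aug_degree : preserves_degree (@degF 0%N) degM aug;
  gfr_aug_surj : forall m, exists x, aug x = m;
  gfr_exact0 : forall x, aug x = 0 <-> exists w, d 0%N w = x;
  gfr_exact : forall i x, d i x = 0 <-> exists w, d i.+1 w = x }.

Definition minimal_graded_free_resolution (M : lmodType A) (degM : grading M)
    (F : nat -> lmodType A) (degF : forall i, grading (F i))
    (d : forall i, F i.+1 -> F i) (aug : F 0%N -> M) : Prop :=
  graded_free_resolution degM degF d aug /\ forall i x, in_AposM (d i x).

(* The degree j part of H_i of the complex F/A_{>=1}F, which is the tensor
   product of F with K = A/A_{>=1}, has dimension n: there are n cycles of
   degree j in F_i that form a basis modulo the boundaries. *)
Section Tor.
Variables (F : nat -> lmodType A) (degF : forall i, grading (F i)).
Variable d : forall i, F i.+1 -> F i.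

Definition tor_cycle (i : nat) : F i -> Prop :=
  match i with
  | 0 => fun=> True
  | k.+1 => fun z => in_AposM (d z)
  end.

Definition tor_boundary (i : nat) (z : F i) : Prop :=
  exists w f, in_AposM f /\ z = d w + f.

Definition tor_dim (i : nat) (j : int) (n : nat) : Prop :=
  exists t : 'I_n -> F i,
    [/\ forall s, degF j (t s) /\ tor_cycle (t s),
        forall c : 'I_n -> K,
          tor_boundary (\sum_s iota (c s) *: t s) -> forall s, c s = 0
      & forall z, degF j z -> tor_cycle z ->
          exists c : 'I_n -> K, tor_boundary (z - \sum_s iota (c s) *: t s)].
End Tor.

(* dim_K Tor_i(M,K)_j = n, computed from any graded free resolution of M. *)
Definition betti (M : lmodType A) (degM : grading M)
    (i : nat) (j : int) (n : nat) : Prop :=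
  (exists (F : nat -> lmodType A) (degF : forall i, grading (F i)) d aug,
     graded_free_resolution degM degF d aug) /\
  (forall (F : nat -> lmodType A) (degF : forall i, grading (F i)) d aug,
     graded_free_resolution degM degF d aug -> tor_dim degF d i j n).

(* The sequence 0 -> A(-2) -d2-> A(-1)^2 -d1-> A, extended by zero modules. *)
Definition seqF (i : nat) : lmodType A :=
  match i with
  | 0 => A^o
  | 1 => (A^o * A^o)%type
  | 2 => A^o
  | _ => 'rV[A]_0
  end.

Definition seqdeg (i : nat) : grading (seqF i) :=
  match i return grading (seqF i) with
  | 0 => fun j x => deg j x
  | 1 => fun j x => deg (j - 1) x.1 /\ deg (j - 1) x.2
  | 2 => fun j x => deg (j - 2) x
  | _ => fun _ _ => True
  end.

Definition seqd (d1 : A * A -> A) (d2 : A -> A * A) (i : nat) :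
    seqF i.+1 -> seqF i :=
  match i return seqF i.+1 -> seqF i with
  | 0 => d1
  | 1 => d2
  | _ => fun=> 0
  end.
End GradedModules.

Section ModuleMy.
Variables (K : fieldType) (alpha : K).
Local Notation B := (BK alpha).
Local Notation y1 := (y1 alpha).
Local Notation y2 := (y2 alpha).

Definition BKscalar (c : K) : B := c%:A.

(* y1 B + y2 B as a right ideal, and B y1 + B y2 as a left ideal. *)
Definition in_yB (z : B) : Prop := exists u v : B, z = y1 * u + y2 * v.
Definition in_By (z : B) : Prop := exists u v : B, z = u * y1 + v * y2.

Fact in_yB0 : in_yB 0.
Proof. by exists 0, 0; rewrite !mulr0 addr0. Qed.
Fact in_yBP (a z t : B) : in_yB z -> in_yB t -> in_yB (z * a + t).
Proof.
move=> [u [v ->]] [u' [v' ->]]; exists (u * a + u'), (v * a + v').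
by rewrite !mulrDr mulrDl !mulrA addrACA.
Qed.
Fact in_By0 : in_By 0.
Proof. by exists 0, 0; rewrite !mul0r addr0. Qed.
Fact in_ByP (a z t : B) : in_By z -> in_By t -> in_By (a * z + t).
Proof.
move=> [u [v ->]] [u' [v' ->]]; exists (a * u + u'), (a * v + v').
by rewrite !mulrDl mulrDr !mulrA addrACA.
Qed.

Definition yB : submodule (B^c^o : lmodType B^c) :=
  @Submodule B^c B^c^o in_yB in_yB0 in_yBP.
Definition By : submodule (B^o : lmodType B) :=
  @Submodule B B^o in_By in_By0 in_ByP.

(* M_y as a right module, and its left counterpart. *)
Definition My : lmodType B^c := quotmod yB.
Definition My_left : lmodType B := quotmod By.

Definition piMy : B -> My := @quotmod_pi _ _ yB.
Definition piMy_left : B -> My_left := @quotmod_pi _ _ By.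

Definition Mydeg : grading My :=
  fun j m => exists2 z, BKdeg j z & m = piMy z.
Definition Mydeg_left : grading My_left :=
  fun j m => exists2 z, BKdeg j z & m = piMy_left z.

(* d1(u,v) = u y1 + v y2 and d2(w) = (w y2, w y1) multiply on the right: they
   are linear for left modules only, e.g. d1((1,0)x2) = x2 y1 while
   d1(1,0)x2 = y1 x2 = x2 y2. The right linear maps with the same entries
   multiply on the left. *)
Definition d1y (p : B * B) : B := p.1 * y1 + p.2 * y2.
Definition d2y (w : B) : B * B := (w * y2, w * y1).
Definition d1y_right (p : B * B) : B := y1 * p.1 + y2 * p.2.
Definition d2y_right (w : B) : B * B := (y2 * w, y1 * w).
End ModuleMy.

(* Main.v *)
Require Import Defs.
From mathcomp Require Import all_boot all_algebra finmap ring.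
From mathcomp Require Import boolp monalg.

Set Implicit Arguments.
Unset Strict Implicit.
Unset Printing Implicit Defensive.

Import GRing.Theory.
Local Open Scope ring_scope.

(** Everything rests on the monomial basis y1^c y2^d x1^a x2^b of B. In this
    basis left multiplication by y1 and y2 only touches the exponents c and d,
    where it is multiplication in the skew polynomial ring on y1, y2 with
    y2 y1 = - y1 y2. Division with remainder by y2 then gives the exactness of
    the complex: if y1 u + y2 v = 0, the remainder of u modulo y2 is killed by
    y1, hence is zero, so u = y2 w, and cancelling y2 gives v = y1 w
    ([BK_y2_regular], [BK_y_syzygy]).

    The monomials span B by straightening. They are independent because B acts
    on the vector space with basis the formal monomials: four operators on a
    vector space that satisfy the six relations make it a B-module
    ([BK_representation]), and the operators given by the straightening rules
    do satisfy them ([pbw_representation]). Acting on the monomial 1 inverts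
    the map from formal monomials to B ([pbw_coordinates]). The basis is made of
    homogeneous elements, so it also yields the grading of B
    ([BK_connected_graded]).

    The left-linear complex multiplies by y1 and y2 on the right. It needs no
    second computation: the opposite algebra of B_K(alpha) is B_K(1/alpha) with
    y1 and y2 exchanged ([BK_opposite]), so the two exactness statements are
    the same one for alpha and 1/alpha. The relations, with alpha invertible,
    also let y1 and y2 move across x1 and x2 in both directions, so that
    y1 B + y2 B = B y1 + B y2 ([in_yB_eq_in_By]).

    Minimality holds because the entries y1, y2 of the differentials have degree
    one. So the complex has zero differential modulo B_{>=1}, and its Tor is
    spanned by the bases of its terms. Since Betti numbers are
    computed here from an arbitrary graded free resolution, the comparison
    theorem is needed: two resolutions are linked by degree-preserving chain
    maps, and the round trips are homotopic to the identity
    ([tor_dim_resolution_independent]). This part is carried out over any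
    connected graded ring with elements Y1, Y2 of degree one, and is applied to
    B and to its converse ring. *)

(** * Linear maps between modules *)

(* The index [i] is kept explicit: [linear] unfolds to a product, so it would
   otherwise be read as the first vector argument. *)
Arguments gfr_d_linear {A deg M degM F degF d aug} _ i : rename.

Arguments gfr_d_degree {A deg M degM F degF d aug} _ i : rename.
Arguments gfr_free {A deg M degM F degF d aug} _ i : rename.

(** The resolutions are given by bare functions with a proof of [linear]; these
    are the usual rules in that unbundled form. *)
Section LinearProp.
Variables (A : nzRingType) (U V W : lmodType A) (f : U -> V).
Hypothesis lf : linear f.

Lemma linear_add x y : f (x + y) = f x + f y.
Proof. by have := lf 1 x y; rewrite !scale1r. Qed.

Lemma linear_zero : f 0 = 0.
Proof. by apply: (addrI (f 0)); rewrite -linear_add !addr0. Qed.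

Lemma linear_scale a x : f (a *: x) = a *: f x.
Proof. by have := lf a x 0; rewrite linear_zero !addr0. Qed.

Lemma linear_opp x : f (- x) = - f x.
Proof. by rewrite -scaleN1r linear_scale scaleN1r. Qed.

Lemma linear_sub x y : f (x - y) = f x - f y.
Proof. by rewrite linear_add linear_opp. Qed.

Lemma linear_combination n (a : 'I_n -> A) (x : 'I_n -> U) :
  f (\sum_s a s *: x s) = \sum_s a s *: f (x s).
Proof.
rewrite (big_morph f linear_add linear_zero).
by apply: eq_bigr => s _; rewrite linear_scale.
Qed.

Lemma linear_compose (g : V -> W) : linear g -> linear (fun x => g (f x)).
Proof. by move=> lg a x y; rewrite lf lg. Qed.

Lemma linear_subtract (g : U -> V) : linear g -> linear (fun x => f x - g x).
Proof.
by move=> lg a x y; rewrite lf lg scalerBr opprD addrACA.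
Qed.
End LinearProp.

(** * Gradings and graded free modules *)

(** A grading in the only two forms that the lifting arguments use. [gr_ind] says
    that homogeneous elements span, as an induction principle, which avoids
    handling decompositions. [gr_comp] says that the sum of the components is
    direct, by projections that need only be correct on homogeneous
    elements. *)
Record is_graded (V : zmodType) (degV : grading V) : Prop := IsGraded {
  gr_0 : forall j, degV j 0;
  gr_D : forall j u v, degV j u -> degV j v -> degV j (u + v);
  gr_N : forall j u, degV j u -> degV j (- u);
  gr_ind : forall P : V -> Prop, P 0 ->
    (forall j u v, degV j u -> P v -> P (u + v)) -> forall v, P v;
  gr_comp : exists pr : int -> V -> V,
    [/\ forall j, {morph pr j : u v / u + v},
        forall j u, degV j u -> pr j u = u
      & forall j k u, degV k u -> k != j -> pr j u = 0] }.

(** A degree-preserving map commutes with taking components: the degree [j]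
    component of any preimage of a degree [j] element is again a preimage. *)
Lemma homogeneous_preimage (V W : zmodType) (degV : grading V)
    (degW : grading W) (p : V -> W) :
    is_graded degV -> is_graded degW ->
    {morph p : u v / u + v} -> preserves_degree degV degW p ->
  forall j v, degW j (p v) -> exists2 v', degV j v' & p v' = p v.
Proof.
move=> gV gW pD pdeg j v; have [pr [prD prK pr0]] := gr_comp gW.
suff [v' v'j pv'] : exists2 v', degV j v' & p v' = pr j (p v).
  by move=> pvj; exists v'; rewrite // pv' prK.
have p0 : p 0 = 0 by apply: (addrI (p 0)); rewrite -pD !addr0.
elim/(gr_ind gV): v => [|k u w uk [w' w'j pw']].
  exists 0; first exact: gr_0.
  by rewrite p0 prK //; exact: gr_0.
rewrite pD prD -pw'; have [kj|kj] := eqVneq k j.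
  rewrite -kj in w'j pw' *; exists (u + w'); first exact: gr_D.
  by rewrite pD prK //; exact: pdeg.
by exists w'; rewrite // (pr0 _ k) ?add0r //; exact: pdeg.
Qed.

Section GradedModules.
Variables (A : nzRingType) (deg : int -> A -> Prop).
Hypothesis gA : is_graded deg.
Hypothesis deg1 : deg 0 1.
Hypothesis degM : forall i j a b, deg i a -> deg j b -> deg (i + j) (a * b).

Section FreeModule.
Variables (F : lmodType A) (degF : grading F).
Hypothesis freeF : graded_free deg degF.

(** The coordinates and the homogeneous basis packed in [graded_free], with the
    coordinates as one function so that they can be used in formulas. *)
Lemma free_coordinates : exists n (e : 'I_n -> int) (b : 'I_n -> F)
    (co : F -> 'I_n -> A),
  [/\ forall x, x = \sum_s co x s *: b s,
      forall c s, co (\sum_s c s *: b s) s = c s,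
      forall a x y s, co (a *: x + y) s = a * co x s + co y s,
      forall j x, degF j x <-> forall s, deg (j - e s) (co x s)
    & forall s, degF (e s) (b s)].
Proof.
have [n [e [b [bP degP]]]] := freeF.
have exco x : exists c : {ffun 'I_n -> A}, unique (fun c : {ffun 'I_n -> A} =>
    x = \sum_s c s *: b s) c by have [c] := bP x; exists c.
have [co coP] := choice exco.
have coK x : x = \sum_s co x s *: b s by have [] := coP x.
have coE (c : 'I_n -> A) : co (\sum_s c s *: b s) = [ffun s => c s].
  have [_] := coP (\sum_s c s *: b s); apply.
  by apply: eq_bigr => s _; rewrite ffunE.
exists n, e, b, (fun x => co x); split=> // [c s|a x y s|j x|s].
- by rewrite coE ffunE.
- rewrite {1}[x]coK {1}[y]coK scaler_sumr -big_split /=.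
  under eq_bigr => t _ do rewrite scalerA -scalerDl.
  by rewrite coE ffunE.
- by rewrite {1}[x]coK; exact: degP.
have -> : b s = \sum_t [ffun t => (t == s)%:R : A] t *: b t.
  rewrite (bigD1 s) //= ffunE eqxx scale1r big1 ?addr0 // => t /negPf ts.
  by rewrite ffunE ts scale0r.
apply/degP => t; rewrite ffunE; case: eqP => [->|_]; last exact: gr_0.
by rewrite subrr.
Qed.

Lemma free_scale_degree i j a x :
  deg i a -> degF j x -> degF (i + j) (a *: x).
Proof.
have [n [e [b [co [coK coE coD degP bdeg]]]]] := free_coordinates.
move=> ai /degP xj; apply/degP => s; rewrite [x]coK scaler_sumr.
under eq_bigr => t _ do rewrite scalerA.
by rewrite (coE (fun t => a * co x t)) -addrA; apply: degM.
Qed.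

Lemma free_is_graded : is_graded degF.
Proof.
have [n [e [b [co [coK coE coD degP bdeg]]]]] := free_coordinates.
have co0 s : co 0 s = 0.
  by have := coD (-1) 0 0 s; rewrite scaler0 addr0 mulN1r addNr.
have coA u v s : co (u + v) s = co u s + co v s.
  by rewrite -[u]scale1r coD mul1r scale1r.
have coN u s : co (- u) s = - co u s.
  by rewrite -[- u]addr0 -scaleN1r coD co0 addr0 mulN1r.
split.
- by move=> j; apply/degP => s; rewrite co0; exact: gr_0.
- by move=> j u v /degP uj /degP vj; apply/degP => s; rewrite coA; apply: gr_D.
- by move=> j u /degP uj; apply/degP => s; rewrite coN; apply: gr_N.
- move=> P P0 PD v; rewrite [v]coK.
  elim: (index_enum _) => [|s r IH]; first by rewrite big_nil.
  rewrite big_cons; elim/(gr_ind gA): (co v s) => [|j a a' aj IHa].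
    by rewrite scale0r add0r.
  by rewrite scalerDl -addrA; apply: PD IHa; apply: free_scale_degree aj (bdeg s).
have [pr [prD prK pr0]] := gr_comp gA.
exists (fun j x => \sum_s pr (j - e s) (co x s) *: b s); split.
- move=> j u v; rewrite -big_split; apply: eq_bigr => s _.
  by rewrite coA prD scalerDl.
- move=> j u /degP uj; rewrite [RHS]coK; apply: eq_bigr => s _.
  by rewrite prK.
- move=> j k u /degP uk kj; rewrite big1 // => s _.
  by rewrite (pr0 _ (k - e s)) ?scale0r // (inj_eq (addIr _)).
Qed.

(** Graded projectivity of free modules: choose homogeneous preimages of the
    basis, which [homogeneous_preimage] provides, and extend linearly. *)
Lemma free_lift (V W : lmodType A) (degV : grading V) (degW : grading W)
    (p : V -> W) (q : F -> W) :
    is_graded degV -> is_graded degW ->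
    (forall i j a x, deg i a -> degV j x -> degV (i + j) (a *: x)) ->
    linear p -> linear q ->
    preserves_degree degV degW p -> preserves_degree degF degW q ->
    (forall x, exists v, p v = q x) ->
  exists f : F -> V,
    [/\ linear f, preserves_degree degF degV f & forall x, p (f x) = q x].
Proof.
move=> gV gW degVZ lp lq pdeg qdeg qp.
have [n [e [b [co [coK coE coD degP bdeg]]]]] := free_coordinates.
have vP s : exists v, degV (e s) v /\ p v = q (b s).
  have [v0 pv0] := qp (b s).
  have [|v vs pv] :=
      homogeneous_preimage gV gW (linear_add lp) pdeg (j := e s) (v := v0).
    by rewrite pv0; apply: qdeg.
  by exists v; rewrite pv.
have [v {}vP] := choice vP.
exists (fun x => \sum_s co x s *: v s); split.
- move=> a x y; rewrite scaler_sumr -big_split.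
  by apply: eq_bigr => s _; rewrite coD scalerDl scalerA.
- move=> j x /degP cj.
  apply: (big_ind (degV j)) => [|u w|s _]; first exact: gr_0.
    exact: gr_D.
  by rewrite -[j](subrK (e s)); apply: degVZ => //; have [] := vP s.
- move=> x; rewrite linear_combination // [in RHS](coK x) linear_combination //.
  by apply: eq_bigr => s _; have [_ ->] := vP s.
Qed.
End FreeModule.

(** * The submodule of elements of positive degree *)

Section AposM.
Variables (F G : lmodType A).

Lemma in_AposM0 : in_AposM deg (0 : F).
Proof.
by exists 0%N, (fun=> 0), (fun=> 0); split=> [[]|] //; rewrite big_ord0.
Qed.

Lemma in_AposMD (x y : F) :
  in_AposM deg x -> in_AposM deg y -> in_AposM deg (x + y).
Proof.
move=> [m [a [f [aP ->]]]] [n [b [g [bP ->]]]].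
exists (m + n)%N,
  (fun k => match split k with inl i => a i | inr i => b i end),
  (fun k => match split k with inl i => f i | inr i => g i end).
split=> [k|]; first by case: (split k).
rewrite big_split_ord; congr (_ + _); apply: eq_bigr => i _.
  by rewrite (unsplitK (inl i)).
by rewrite (unsplitK (inr i)).
Qed.

(** This is where [in_Apos], a sum of one element in each degree up to a bound,
    is produced: the last summand is [a] and the others vanish. *)
Lemma in_AposM_homogeneous m a (x : F) :
  deg (Posz m.+1) a -> in_AposM deg (a *: x).
Proof.
move=> am; exists 1%N, (fun=> a), (fun=> x); split; last by rewrite big_ord1.
move=> _; exists m.+1, (fun k : 'I_m.+1 => if k == ord_max then a else 0).
split=> [k|]; first by case: eqP => [->|_] //; exact: gr_0.
by rewrite -big_mkcond big_pred1_eq.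
Qed.

Lemma in_AposM_scale b (x : F) :
  deg 0 b -> in_AposM deg x -> in_AposM deg (b *: x).
Proof.
move=> b0 [n [a [y [aP ->]]]]; exists n, (fun k => b * a k), y; split=> [k|].
  have [m [c [cP ->]]] := aP k; exists m, (fun l => b * c l); split=> [l|].
    by rewrite -[Posz l.+1]add0r; apply: degM.
  exact: mulr_sumr.
by rewrite scaler_sumr; apply: eq_bigr => k _; rewrite scalerA.
Qed.

Lemma in_AposM_image (f : F -> G) x :
  linear f -> in_AposM deg x -> in_AposM deg (f x).
Proof.
move=> lf [n [a [y [aP ->]]]]; exists n, a, (f \o y); split=> //.
exact: linear_combination.
Qed.
End AposM.

Lemma tor_boundaryD (F : nat -> lmodType A) (d : forall i, F i.+1 -> F i)
    i (x y : F i) : linear (d i) ->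
  tor_boundary deg d x -> tor_boundary deg d y -> tor_boundary deg d (x + y).
Proof.
move=> ld [w [f [fP ->]]] [w' [f' [f'P ->]]]; exists (w + w'), (f + f').
by rewrite (linear_add ld) addrACA; split=> //; apply: in_AposMD.
Qed.

(** * Comparison of graded free resolutions *)

Section Comparison.
Variables (M : lmodType A) (degMod : grading M).
Hypothesis gM : is_graded degMod.

Section ChainMap.
Variables (F : nat -> lmodType A) (degF : forall i, grading (F i)).
Variables (dF : forall i, F i.+1 -> F i) (augF : F 0%N -> M).
Variables (G : nat -> lmodType A) (degG : forall i, grading (G i)).
Variables (dG : forall i, G i.+1 -> G i) (augG : G 0%N -> M).
Arguments dF : clear implicits.
Arguments dG : clear implicits.
Hypothesis rF : graded_free_resolution deg degMod degF dF augF.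
Hypothesis rG : graded_free_resolution deg degMod degG dG augG.

Lemma complex_dd i x : dF i (dF i.+1 x) = 0.
Proof. by apply/(gfr_exact rF); exists x. Qed.

Lemma complex_augd x : augF (dF 0%N x) = 0.
Proof. by apply/(gfr_exact0 rF); exists x. Qed.

Let gF i := free_is_graded (gfr_free rF i).
Let gG i := free_is_graded (gfr_free rG i).

(** The invariant that lets a chain map be extended by one more degree. Stating
    it with images of the differentials, not kernels, makes it the same at the
    augmentation and further up. *)
Definition liftable i (f : F i -> G i) :=
  [/\ linear f, preserves_degree (@degF i) (@degG i) f
    & forall w, exists w', dG i w' = f (dF i w)].

Lemma chain_map_step i (f : F i -> G i) : liftable f ->
  exists f', liftable f' /\ forall x, dG i (f' x) = f (dF i x).
Proof.
move=> [lf fdeg fim].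
have [||||||f' [lf' f'deg f'E]] :=
  free_lift (gfr_free rF i.+1) (gG i.+1) (gG i) _ (p := dG i)
    (q := fun x => f (dF i x)).
- exact: free_scale_degree (gfr_free rG _).
- exact: gfr_d_linear rG i.
- exact (linear_compose (gfr_d_linear rF i) lf).
- exact: gfr_d_degree rG i.
- by move=> j x xj; apply/fdeg/(gfr_d_degree rF i).
- by move=> x; exact: fim.
exists f'; split=> //; split=> // w.
apply/(gfr_exact rG); rewrite f'E complex_dd.
exact: linear_zero.
Qed.

Lemma chain_map_start :
  exists f : F 0%N -> G 0%N, liftable f /\ forall x, augG (f x) = augF x.
Proof.
have [||||||f [lf fdeg fE]] :=
  free_lift (gfr_free rF 0%N) (gG 0%N) gM _ (p := augG) (q := augF).
- exact: free_scale_degree (gfr_free rG _).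
- exact: gfr_aug_linear rG.
- exact: gfr_aug_linear rF.
- exact: gfr_aug_degree rG.
- exact: gfr_aug_degree rF.
- move=> x; exact: gfr_aug_surj rG _.
exists f; split=> //; split=> // w.
by apply/(gfr_exact0 rG); rewrite fE complex_augd.
Qed.

(** The next component depends on the previous one only through [liftable], so
    the whole sequence comes from a recursion on dependent pairs, with a choice
    at each step. *)
Lemma chain_map_exists : exists f : forall i, F i -> G i,
  [/\ forall i, linear (f i),
      forall i, preserves_degree (@degF i) (@degG i) (f i),
      forall x, augG (f 0%N x) = augF x
    & forall i x, dG i (f i.+1 x) = f i (dF i x)].
Proof.
have [f0 [f0P f0E]] := chain_map_start.
pose state i := {f : F i -> G i | liftable f}.
have step i (s : state i) : {t : state i.+1 |
    forall x, dG i (sval t x) = sval s (dF i x)}.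
  have [f' f'P] := cid (chain_map_step (svalP s)).
  by exists (exist _ f' (proj1 f'P)); exact: proj2 f'P.
pose s := nat_rect state (exist _ f0 f0P) (fun i s => sval (step i s)).
exists (fun i => sval (s i)); split=> // [i|i|i x].
- by have [] := svalP (s i).
- by have [] := svalP (s i).
- exact: (svalP (step i (s i))).
Qed.
End ChainMap.

Section Homotopy.
Variables (F : nat -> lmodType A) (degF : forall i, grading (F i)).
Variables (d : forall i, F i.+1 -> F i) (aug : F 0%N -> M).
Arguments d : clear implicits.
Hypothesis rF : graded_free_resolution deg degMod degF d aug.
Variable e : forall i, F i -> F i.
Arguments e : clear implicits.
Hypothesis le : forall i, linear (e i).
Hypothesis edeg : forall i, preserves_degree (@degF i) (@degF i) (e i).
Hypothesis aug_e : forall x, aug (e 0%N x) = 0.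
Hypothesis d_e : forall i x, d i (e i.+1 x) = e i (d i x).

Let gF i := free_is_graded (gfr_free rF i).
Let ld : forall i, linear (d i) := gfr_d_linear rF.
Arguments ld : clear implicits.

(** A chain endomorphism over the zero map of [M] is null-homotopic. Only two
    consecutive maps of the homotopy matter at a time, so the induction carries
    the single map [h] in degree [i] and the identity that the next step needs
    to lift. From [e = d h + h d], a cycle modulo A_{>=1} goes to a boundary
    modulo A_{>=1}, because [h] preserves A_{>=1} multiples. *)
Lemma null_homotopic i :
  exists h : F i -> F i.+1,
  [/\ linear h, preserves_degree (@degF i) (@degF i.+1) h,
      forall x, d i (e i.+1 x - h (d i x)) = 0
    & forall z : F i, tor_cycle deg d z -> tor_boundary deg d (e i z)].
Proof.
elim: i => [|i [h [lh hdeg hE _]]].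
  have [||||||h [lh hdeg hE]] :=
    free_lift (gfr_free rF 0%N) (gF 1%N) (gF 0%N) _ (p := d 0%N) (q := e 0%N).
  - exact: free_scale_degree (gfr_free rF _).
  - exact: ld.
  - exact: le.
  - exact: gfr_d_degree rF _.
  - exact: edeg.
  - by move=> x; apply/(gfr_exact0 rF).
  exists h; split=> // [x|z _].
    by rewrite (linear_sub (ld _)) d_e hE subrr.
  by exists (h z), 0; rewrite hE addr0; split=> //; exact: in_AposM0.
pose q := fun x => e i.+1 x - h (d i x).
have lq : linear q.
  by apply: linear_subtract => //; exact: (linear_compose (ld i) lh).
have [||||||h' [lh' h'deg h'E]] :=
    free_lift (gfr_free rF i.+1) (gF i.+2) (gF i.+1) _ (p := d i.+1) (q := q).
- exact: free_scale_degree (gfr_free rF _).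
- exact: ld.
- exact: lq.
- exact: gfr_d_degree rF _.
- move=> j x xj; apply: gr_D; first exact: gF.
    exact: edeg.
  apply: gr_N; first exact: gF.
  exact/hdeg/(gfr_d_degree rF i).
- by move=> x; apply/(gfr_exact rF); exact: hE.
exists h'; split=> // [x|z zc].
  rewrite (linear_sub (ld _)) d_e h'E /q (complex_dd rF).
  by rewrite (linear_zero lh) subr0 subrr.
exists (h' z), (h (d i z)); split; first exact: in_AposM_image.
by rewrite h'E subrK.
Qed.
End Homotopy.

Section ChainMapFunctoriality.
Variables F G : nat -> lmodType A.
Variables (dF : forall i, F i.+1 -> F i) (dG : forall i, G i.+1 -> G i).
Arguments dF : clear implicits.
Arguments dG : clear implicits.

Lemma chain_map_cycle (f : forall i, F i -> G i) i (z : F i) :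
    (forall i, linear (f i)) ->
    (forall i x, dG i (f i.+1 x) = f i (dF i x)) ->
  tor_cycle deg dF z -> tor_cycle deg dG (f i z).
Proof.
by case: i z => [|i] z lf fE //= zc; rewrite fE; apply: in_AposM_image.
Qed.

Lemma chain_map_boundary (f : forall i, F i -> G i) i (z : F i) :
    (forall i, linear (f i)) ->
    (forall i x, dG i (f i.+1 x) = f i (dF i x)) ->
  tor_boundary deg dF z -> tor_boundary deg dG (f i z).
Proof.
move=> lf fE [w [x [xP ->]]]; exists (f i.+1 w), (f i x).
by rewrite fE (linear_add (lf i)); split=> //; exact: in_AposM_image.
Qed.
End ChainMapFunctoriality.

(** An endomorphism of a resolution over the identity of [M] acts as the identity
    on Tor. *)
Lemma chain_endomorphism_boundary
    (F : nat -> lmodType A) (degF : forall i, grading (F i))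
    (d : forall i, F i.+1 -> F i) (aug : F 0%N -> M)
    (u : forall i, F i -> F i) i (z : F i) :
    graded_free_resolution deg degMod degF d aug ->
    (forall i, linear (u i)) ->
    (forall i, preserves_degree (@degF i) (@degF i) (u i)) ->
    (forall x, aug (u 0%N x) = aug x) ->
    (forall i x, d i (u i.+1 x) = u i (d i x)) ->
  tor_cycle deg d z -> tor_boundary deg d (z - u i z).
Proof.
move=> rF lu udeg uaug uE zc.
have [||||h [_ _ _]] := null_homotopic rF (e := fun i x => x - u i x) _ _ _ _ i.
- by move=> k; apply: linear_subtract.
- move=> k j x xj; have gF := free_is_graded (gfr_free rF k).
  by apply: gr_D => //; apply: gr_N => //; exact: udeg.
- by move=> x; rewrite (linear_sub (gfr_aug_linear rF)) uaug subrr.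
- by move=> k x; rewrite (linear_sub (gfr_d_linear rF _)) uE.
exact.
Qed.

Lemma tor_cycle_combination
    (F : nat -> lmodType A) (degF : forall i, grading (F i))
    (d : forall i, F i.+1 -> F i) (aug : F 0%N -> M) i n
    (a : 'I_n -> A) (t : 'I_n -> F i) :
    graded_free_resolution deg degMod degF d aug ->
    (forall s, deg 0 (a s)) -> (forall s, tor_cycle deg d (t s)) ->
  tor_cycle deg d (\sum_s a s *: t s).
Proof.
case: i t => [|i] t rF a0 tc //=.
rewrite (linear_combination (gfr_d_linear rF i)).
apply: big_ind => [|u v|s _]; [exact: in_AposM0|exact: in_AposMD|].
by apply: in_AposM_scale => //; exact: tc.
Qed.

(** A basis of Tor computed in one resolution is carried to a basis in the other
    one by a comparison map; both round trips are the identity on Tor. *)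
Lemma tor_dim_resolution_independent (K : fieldType) (iota : K -> A)
    (F : nat -> lmodType A) (degF : forall i, grading (F i))
    (dF : forall i, F i.+1 -> F i) (augF : F 0%N -> M)
    (G : nat -> lmodType A) (degG : forall i, grading (G i))
    (dG : forall i, G i.+1 -> G i) (augG : G 0%N -> M) i j n :
    (forall c, deg 0 (iota c)) ->
    graded_free_resolution deg degMod degF dF augF ->
    graded_free_resolution deg degMod degG dG augG ->
  tor_dim iota deg degF dF i j n -> tor_dim iota deg degG dG i j n.
Proof.
move=> iota0 rF rG [t [tP tfree tspan]].
have [f [lf fdeg faug fE]] := chain_map_exists rF rG.
have [g [lg gdeg gaug gE]] := chain_map_exists rG rF.
have gf (z : F i) : tor_cycle deg dF z -> tor_boundary deg dF (z - g i (f i z)).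
  apply: (chain_endomorphism_boundary (u := fun i x => g i (f i x)) rF).
  - by move=> k; exact: linear_compose.
  - by move=> k l x /fdeg /gdeg.
  - by move=> x; rewrite gaug faug.
  - by move=> k x; rewrite gE fE.
have fg (z : G i) : tor_cycle deg dG z -> tor_boundary deg dG (z - f i (g i z)).
  apply: (chain_endomorphism_boundary (u := fun i x => f i (g i x)) rG).
  - by move=> k; exact: linear_compose.
  - by move=> k l x /gdeg /fdeg.
  - by move=> x; rewrite faug gaug.
  - by move=> k x; rewrite fE gE.
exists (fun s => f i (t s)); split.
- move=> s; have [tj tc] := tP s; split; first exact: fdeg.
  exact: chain_map_cycle.
- move=> c; rewrite -(linear_combination (lf i)); set y := \sum_s _ => yb.
  apply: tfree; rewrite -/y -[y](subrK (g i (f i y))).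
  apply: tor_boundaryD; first exact: (gfr_d_linear rF _).
    apply/gf/(tor_cycle_combination rF) => // s; exact: (proj2 (tP s)).
  exact: chain_map_boundary yb.
- move=> z zj zc; have [c cP] := tspan _ (gdeg _ _ _ zj) (chain_map_cycle lg gE zc).
  exists c; rewrite -(linear_combination (lf i)) -[z](subrK (f i (g i z))) -addrA.
  apply: tor_boundaryD; first exact: (gfr_d_linear rG _).
    exact: fg.
  by rewrite -(linear_sub (lf i)); exact: chain_map_boundary.
Qed.
End Comparison.
End GradedModules.

(** * The resolution of a quotient by two anticommuting elements *)

(** The part of the structure of a connected graded algebra that enters the
    computation of Tor. It is symmetric under passing to the converse ring. *)
Record connected_graded (K : fieldType) (A : nzRingType) (iota : K -> A)
    (deg : int -> A -> Prop) : Prop := ConnectedGraded {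
  cg_graded : is_graded deg;
  cg_deg1 : deg 0 1;
  cg_degM : forall i j a b, deg i a -> deg j b -> deg (i + j) (a * b);
  cg_neg : forall n a, deg (Negz n) a -> a = 0;
  cg_iota : forall c, deg 0 (iota c);
  cg_scalar : forall a, deg 0 a -> exists c, a = iota c;
  cg_iota_eq0 : forall c, iota c = 0 -> c = 0 }.

Section KoszulResolution.
Variables (K : fieldType) (A : nzRingType) (iota : K -> A).
Variable deg : int -> A -> Prop.
Hypothesis cgA : connected_graded iota deg.
Let gA := cg_graded cgA.
Let degM := cg_degM cgA.

(** The left factor [a] need not be homogeneous: [A] is graded in nonnegative
    degrees, so each component of [a * y] has positive degree. *)
Lemma mul_degree1_AposM (F : lmodType A) a y (x : F) :
  deg 1 y -> in_AposM deg ((a * y) *: x).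
Proof.
move=> y1; elim/(gr_ind gA): a => [|j a b aj IH].
  by rewrite mul0r scale0r; exact: in_AposM0.
rewrite mulrDl scalerDl; apply: in_AposMD IH.
case: j aj => [m|m] aj; last first.
  by rewrite (cg_neg cgA aj) mul0r scale0r; exact: in_AposM0.
by apply: (in_AposM_homogeneous gA (m := m)); rewrite -addn1 PoszD; apply: degM.
Qed.

Lemma nonzero_degree_AposM (F : lmodType A) j a (x : F) :
  deg j a -> j != 0 -> in_AposM deg (a *: x).
Proof.
case: j => [[|m]|m] // am _; first exact: in_AposM_homogeneous am.
by rewrite (cg_neg cgA am) scale0r; exact: in_AposM0.
Qed.

(** The degree zero component kills A_{>=1} A and fixes scalars: this is what
    makes A/A_{>=1} one-dimensional and the bases below independent in Tor. *)
Lemma scalar_AposM c : in_AposM deg (iota c : A^o) -> c = 0.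
Proof.
have [pr [prD prK pr0]] := gr_comp gA.
have prZ j : pr j 0 = 0 by apply: prK; exact: gr_0.
have pr_sum n (g : 'I_n -> A) : (forall k, pr 0 (g k) = 0) -> pr 0 (\sum_k g k) = 0.
  move=> g0; elim: (index_enum _) => [|k s IH]; first by rewrite big_nil prZ.
  by rewrite big_cons prD g0 IH addr0.
move=> cpos; apply: (cg_iota_eq0 cgA); rewrite -[iota c](prK 0); last exact: (cg_iota cgA).
have [n [a [f [aP ->]]]] := cpos; apply: (pr_sum) => k.
have [m [b [bP ->]]] := aP k.
rewrite scaler_suml; apply: pr_sum => l.
elim/(gr_ind gA): (f k) => [|j x y xj IH]; first by rewrite scaler0 prZ.
rewrite scalerDr prD IH addr0; case: j xj => [p|p] xj.
  by apply: (pr0 _ (Posz l.+1 + Posz p)) => //; exact: degM.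
by rewrite (cg_neg cgA xj) scaler0 prZ.
Qed.

Variables Y1 Y2 : A.
Hypothesis Y1deg : deg 1 Y1.
Hypothesis Y2deg : deg 1 Y2.
Hypothesis Y21 : Y2 * Y1 = - (Y1 * Y2).
Hypothesis Y2_regular : forall w, w * Y2 = 0 -> w = 0.
Hypothesis Y_syzygy : forall u v, u * Y1 + v * Y2 = 0 ->
  exists w, u = w * Y2 /\ v = w * Y1.

Variables (M : lmodType A) (degMod : grading M) (aug : A^o -> M).
Hypothesis laug : linear aug.
Hypothesis augP : forall m, exists z, aug z = m.
Hypothesis degModE : forall j m, degMod j m <-> exists2 z, deg j z & m = aug z.
Hypothesis aug0P : forall z, aug z = 0 <-> exists u v, z = u * Y1 + v * Y2.

(** The left ideal generated by [Y1] and [Y2] is homogeneous: the degree [j]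
    component of [u * Y1 + v * Y2] is obtained from the components of [u] and
    [v] in degree [j - 1]. So components pass to the quotient. *)
Lemma cyclic_quotient_is_graded : is_graded degMod.
Proof.
have [pr [prD prK pr0]] := gr_comp gA.
have prZ j : pr j 0 = 0 by apply: prK; exact: gr_0.
have pr_mul j u y : deg 1 y -> pr j (u * y) = pr (j - 1) u * y.
  move=> y1; elim/(gr_ind gA): u => [|k a b ak IH]; first by rewrite mul0r !prZ mul0r.
  rewrite mulrDl !prD IH mulrDl; congr (_ + _).
  have [kj|kj] := eqVneq k (j - 1).
    rewrite -kj [pr k a]prK // prK //.
    by rewrite -[j](subrK 1) -kj; apply: degM.
  rewrite (pr0 (j - 1) k a) // mul0r (pr0 j (k + 1)) //; first exact: degM.
  by apply: contraNneq kj => <-; rewrite addrK.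
have pr_ker j z : aug z = 0 -> aug (pr j z) = 0.
  move=> /aug0P[u [v ->]]; apply/aug0P; exists (pr (j - 1) u), (pr (j - 1) v).
  by rewrite prD !pr_mul.
have [r rK] := choice augP.
have prE j z : aug (pr j (r (aug z))) = aug (pr j z).
  rewrite -{1}[r (aug z)](subrK z) prD (linear_add laug) pr_ker ?add0r //.
  by rewrite (linear_sub laug) rK subrr.
split.
- move=> j; apply/degModE; exists 0; first exact: (gr_0 gA).
  by rewrite -(linear_zero laug).
- move=> j u v /degModE[a aj ->] /degModE[b bj ->]; apply/degModE.
  by exists (a + b); [exact: (gr_D gA)|rewrite -(linear_add laug)].
- move=> j u /degModE[a aj ->]; apply/degModE.
  by exists (- a); [exact: (gr_N gA)|rewrite -(linear_opp laug)].
- move=> P P0 PD m; have [z <-] := augP m.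
  elim/(gr_ind gA): z => [|j a b aj IH]; first by rewrite (linear_zero laug).
  rewrite (linear_add laug); apply: (PD j) IH.
  by apply/degModE; exists a.
exists (fun j m => aug (pr j (r m))); split.
- move=> j u v; rewrite -[u]rK -[v]rK -(linear_add laug) !prE.
  by rewrite prD (linear_add laug).
- by move=> j u /degModE[a aj ->]; rewrite prE prK.
- by move=> j k u /degModE[a ak ->] kj; rewrite prE (pr0 _ k) ?(linear_zero laug).
Qed.

Let d1 (p : A * A) : A := p.1 * Y1 + p.2 * Y2.
Let d2 (w : A) : A * A := (w * Y2, w * Y1).

Definition pair_basis (s : 'I_2) : A^o * A^o :=
  if s == ord0 then (1, 0) else (0, 1).

Lemma ord2P (s : 'I_2) : s = ord0 \/ s = ord_max.
Proof. by case: s => [[|[|//]]] ?; [left|right]; exact: val_inj. Qed.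

Lemma sum_pair_basis (c : 'I_2 -> A) :
  \sum_s c s *: pair_basis s = (c ord0, c ord_max).
Proof.
rewrite big_ord_recl big_ord1 /pair_basis /=; congr (_, _) => /=.
  by rewrite [_ *: _]mulr1 [_ *: _]mulr0 addr0.
rewrite [c ord0 *: _]mulr0 add0r [_ *: _]mulr1; congr c.
exact: val_inj.
Qed.

Lemma koszul_terms_free i : graded_free deg (@seqdeg A deg i).
Proof.
have deg0 j : deg j 0 by exact: gr_0.
case: i => [|[|[|i]]] /=.
- exists 1%N, (fun=> 0), (fun=> 1 : A^o); split=> [x|j c].
    exists [ffun=> x]; split=> [|c ->]; first by rewrite big_ord1 ffunE [_ *: _]mulr1.
    by apply/ffunP => s; rewrite ffunE big_ord1 [_ *: _]mulr1 (ord1 s).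
  rewrite big_ord1 [_ *: _]mulr1 subr0; split=> [cj s|]; last exact.
  by rewrite (ord1 s).
- exists 2%N, (fun=> 1), pair_basis; split=> [x|j c].
    exists [ffun s => if s == ord0 then x.1 else x.2].
    split=> [|c ->]; first by rewrite sum_pair_basis !ffunE; case: x.
    by apply/ffunP => s; rewrite ffunE sum_pair_basis; case: (ord2P s) => ->.
  rewrite sum_pair_basis; split=> [[c0 c1] s|cs]; first by case: (ord2P s) => ->.
  by split; apply: cs.
- exists 1%N, (fun=> 2), (fun=> 1 : A^o); split=> [x|j c].
    exists [ffun=> x]; split=> [|c ->]; first by rewrite big_ord1 ffunE [_ *: _]mulr1.
    by apply/ffunP => s; rewrite ffunE big_ord1 [_ *: _]mulr1 (ord1 s).
  rewrite big_ord1 [_ *: _]mulr1; split=> [cj s|]; last exact.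
  by rewrite (ord1 s).
- exists 0%N, (fun=> 0), (fun=> 0); split=> [x|j c]; last by split=> // _ [].
  exists [ffun=> 0]; split=> [|c _]; last by apply/ffunP => [[]].
  by rewrite big_ord0; apply/matrixP => ? [].
Qed.

Lemma koszul_resolution :
  graded_free_resolution deg degMod (@seqdeg A deg) (@seqd A d1 d2) aug.
Proof.
split=> //.
- exact: koszul_terms_free.
- case=> [|[|i]] a u v /=.
  + have scaleE (b c : A) : b *: (c : A^o) = b * c by [].
    by rewrite /d1 /= !scaleE !mulrDl mulrDr !mulrA addrACA.
  + by congr (_, _) => /=; rewrite mulrDl; congr (_ + _); exact: esym (mulrA _ _ _).
  + by rewrite scaler0 addr0.
- have degE j a y : deg (j - 1) a -> deg 1 y -> deg j (a * y).
    by move=> aj y1; rewrite -[j](subrK 1); apply: degM.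
  case=> [|[|i]] j x /=.
  + by case=> x1 x2; apply: gr_D => //; apply: degE.
  + move=> xj; have {}xj : deg (j - 1 - 1) x by rewrite -addrA -opprD.
    by split; apply: degE.
  + by case: i x => [|i] x _ //=; exact: (gr_0 gA).
- by move=> j x xj; apply/degModE; exists x.
- move=> z; split=> [/aug0P[u [v ->]]|[[u v] <-]]; first by exists (u, v).
  by apply/aug0P; exists u, v.
- case=> [|[|i]] x /=.
  + split=> [|[w <-]].
      by case: x => u v uv; have [w [-> ->]] := @Y_syzygy u v uv; exists w.
    by rewrite /d1 /= -!mulrA Y21 mulrN addNr.
  + split=> [[w2 _]|[w <-]]; last by rewrite /d2 !mul0r.
    by exists 0; rewrite (Y2_regular w2).
  + by split=> // _; exists 0; apply/matrixP => ? [].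
Qed.

Lemma koszul_minimal :
  minimal_graded_free_resolution deg degMod (@seqdeg A deg) (@seqd A d1 d2) aug.
Proof.
split=> [|[|[|i]] x /=]; first exact: koszul_resolution.
- rewrite /d1 -[x.1 * _]mulr1 -[x.2 * _]mulr1.
  by apply: (@in_AposMD _ _ A^o); apply: (@mul_degree1_AposM A^o).
- have -> : d2 x = (x * Y2) *: ((1, 0) : A^o * A^o) + (x * Y1) *: (0, 1).
    by congr (_, _) => /=; rewrite [_ *: 1]mulr1 [_ *: 0]mulr0 ?addr0 ?add0r.
  by apply: in_AposMD; apply: mul_degree1_AposM.
- exact: in_AposM0.
Qed.

(** Boundaries add nothing modulo A_{>=1}, by minimality; hence Tor is spanned by
    the bases of the terms. *)
Lemma koszul_boundary i (x : seqF A i) :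
  tor_boundary deg (@seqd A d1 d2) x -> in_AposM deg x.
Proof.
move=> [w [f [fP ->]]]; apply: in_AposMD fP; exact: (proj2 koszul_minimal).
Qed.

Lemma tor_boundary_AposM i (x : seqF A i) :
  in_AposM deg x -> tor_boundary deg (@seqd A d1 d2) x.
Proof.
move=> xP; exists 0, x; split=> //.
by rewrite (linear_zero (gfr_d_linear koszul_resolution i)) add0r.
Qed.

Lemma koszul_tor0 : tor_dim iota deg (@seqdeg A deg) (@seqd A d1 d2) 0 0 1.
Proof.
exists (fun=> 1 : A^o); split=> [s|c|z z0 _].
- by split=> //=; exact: (cg_deg1 cgA).
- rewrite big_ord1 [_ *: _]mulr1 => /koszul_boundary /scalar_AposM c0 s.
  by rewrite (ord1 s).
have [c ->] := cg_scalar cgA z0; exists (fun=> c); apply: tor_boundary_AposM.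
by rewrite big_ord1 [_ *: _]mulr1 subrr; exact: in_AposM0.
Qed.

Lemma koszul_tor2 : tor_dim iota deg (@seqdeg A deg) (@seqd A d1 d2) 2 2 1.
Proof.
exists (fun=> 1 : A^o); split=> [s|c|z z0 _].
- by split=> /=; [exact: (cg_deg1 cgA)|exact: (proj2 koszul_minimal 1%N)].
- rewrite big_ord1 [_ *: _]mulr1 => /koszul_boundary /scalar_AposM c0 s.
  by rewrite (ord1 s).
have [c ->] := cg_scalar cgA z0; exists (fun=> c); apply: tor_boundary_AposM.
by rewrite big_ord1 [_ *: _]mulr1 subrr; exact: in_AposM0.
Qed.

Lemma koszul_tor1 : tor_dim iota deg (@seqdeg A deg) (@seqd A d1 d2) 1 1 2.
Proof.
exists pair_basis; split=> [s|c|z z0 _].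
- split; last exact: (proj2 koszul_minimal 0%N).
  have [deg0 deg1] := (gr_0 gA 0, cg_deg1 cgA).
  by rewrite /pair_basis; case: ifP.
- rewrite sum_pair_basis => /koszul_boundary cpos.
  have c0 : c ord0 = 0.
    apply: scalar_AposM.
    exact: (in_AposM_image (f := fst) (G := A^o)) cpos.
  have c1 : c ord_max = 0.
    apply: scalar_AposM.
    exact: (in_AposM_image (f := snd) (G := A^o)) cpos.
  move=> s; by case: (ord2P s) => ->.
case: z z0 => z1 z2 [/= /(cg_scalar cgA)[c ->] /(cg_scalar cgA)[e ->]].
exists (fun s => if s == ord0 then c else e); apply: tor_boundary_AposM.
by rewrite sum_pair_basis /= subrr; exact: in_AposM0.
Qed.

Lemma koszul_tor_vanishing i j :
    (i, j) \notin [:: (0%N, 0); (1%N, 1); (2%N, 2)] ->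
  tor_dim iota deg (@seqdeg A deg) (@seqd A d1 d2) i j 0.
Proof.
move=> ij; exists (fun=> 0); split=> [[]|c _ []|z zj _] //.
exists (fun=> 0); apply: tor_boundary_AposM; rewrite big_ord0 subr0.
case: i ij z zj => [|[|[|i]]]; rewrite !inE !xpair_eqE /= ?orbF.
- move=> j0 z zj; rewrite -[z]mulr1.
  exact: (nonzero_degree_AposM (F := A^o) _ zj).
- move=> j1 [z1 z2] [/= z1j z2j]; rewrite -subr_eq0 in j1.
  have -> : (z1, z2) = z1 *: ((1, 0) : A^o * A^o) + z2 *: (0, 1).
    by congr (_, _) => /=; rewrite [_ *: 1]mulr1 [_ *: 0]mulr0 ?addr0 ?add0r.
  apply: in_AposMD; first exact: nonzero_degree_AposM z1j _.
  exact: nonzero_degree_AposM z2j _.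
- move=> j2 z zj; rewrite -subr_eq0 in j2.
  by rewrite -[z]mulr1; exact: (nonzero_degree_AposM (F := A^o) _ zj).
- move=> _ z _; have -> : z = 0 by apply/matrixP => ? [].
  exact: in_AposM0.
Qed.

Lemma koszul_betti : let beta := betti iota deg degMod in
  [/\ beta 0%N 0 1%N, beta 1%N 1 2%N, beta 2%N 2 1%N
    & forall (i : nat) (j : int),
        (i, j) \notin [:: (0%N, 0); (1%N, 1); (2%N, 2)] -> beta i j 0%N].
Proof.
have bettiE i j n : tor_dim iota deg (@seqdeg A deg) (@seqd A d1 d2) i j n ->
    betti iota deg degMod i j n.
  move=> tor_n; split=> [|F degF d a rF].
    by do 4!eexists; exact: koszul_resolution.
  apply: (tor_dim_resolution_independent gA (cg_deg1 cgA) degM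
    cyclic_quotient_is_graded (cg_iota cgA) koszul_resolution rF tor_n).
split=> [|||i j ij]; apply: bettiE.
- exact: koszul_tor0.
- exact: koszul_tor1.
- exact: koszul_tor2.
- exact: koszul_tor_vanishing.
Qed.
End KoszulResolution.

(** * Representations of the algebra B *)

Section LinearExtension.
Variables (K : fieldType) (T : choiceType) (V : lmodType K) (f : T -> V).

Lemma malg_ind (P : {malg K[T]} -> Prop) :
  P 0 -> (forall c k v, P v -> P (c *: << k >> + v)) -> forall v, P v.
Proof.
move=> P0 PD v; rewrite [v]monalgE.
elim: (X in \sum_(k <- X) _) => [|k s IH]; first by rewrite big_nil.
rewrite big_cons (_ : << v@_k *g k >> = v@_k *: << k >>); first exact: PD.
by apply/malgP => l; rewrite mcoeffZ !mcoeffU mulr_natr.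
Qed.

Definition malg_extend (g : {malg K[T]}) : V := \sum_(k <- msupp g) g@_k *: f k.

Lemma malg_extendEw (d : {fset T}) g : (msupp g `<=` d)%fset ->
  malg_extend g = \sum_(k <- d) g@_k *: f k.
Proof.
move=> le; rewrite /malg_extend; apply: big_fset_incl => //.
by move=> x _ /mcoeff_outdom ->; rewrite scale0r.
Qed.

Lemma malg_extend_linear : linear malg_extend.
Proof.
move=> c g h; pose d := (msupp (c *: g + h) `|` (msupp g `|` msupp h))%fset.
rewrite !(malg_extendEw (d := d)) ?fsubsetUl //; last 2 first.
- exact: fsubset_trans (fsubsetUr _ _) (fsubsetUr _ _).
- exact: fsubset_trans (fsubsetUl _ _) (fsubsetUr _ _).
rewrite scaler_sumr -big_split; apply: eq_bigr => k _ /=.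
by rewrite mcoeffD mcoeffZ scalerDl scalerA.
Qed.

Lemma malg_extendU k : malg_extend << k >> = f k.
Proof.
by rewrite (malg_extendEw msuppU_le) big_seq_fset1 mcoeffUU scale1r.
Qed.
End LinearExtension.

Section LinearMaps.
Variables (K : fieldType) (U V : lmodType K) (f : U -> V).
Hypothesis lf : linear f.

Lemma linear_negate : linear (fun v => - f v).
Proof. by move=> c u v; rewrite lf opprD scalerN. Qed.

Lemma linear_multiple s : linear (fun v => s *: f v).
Proof. by move=> c u v; rewrite lf scalerDr !scalerA mulrC. Qed.
End LinearMaps.

Lemma ord4P (i : 'I_4) : [\/ i = inord 0, i = inord 1, i = inord 2 | i = inord 3].
Proof.
case: i => [[|[|[|[|//]]]]] ?; [constructor 1|constructor 2|constructor 3|constructor 4];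
  by apply: val_inj; rewrite /= inordK.
Qed.

Section Presentation.
Variables (K : fieldType) (alpha : K).
Local Notation B := (BK alpha).
Local Notation free := (freealg K).

Lemma BKquotient_word (w : {fmonom 'I_4}) :
  qalg_pi (BKquotient alpha) (<< w >> : free) = \prod_(i <- w) BKgen alpha i.
Proof.
case: w => s; elim: s => [|i s IH].
  rewrite big_nil; have -> : (<< FMonom [::] >> : free) = 1.
    by congr << _ >>; apply/eqP; rewrite fmP fm1.
  exact: rmorph1.
rewrite big_cons -IH /BKgen -rmorphM; congr (qalg_pi _ _).
rewrite malgM_def fgmulUU mulr1; congr << _ >>.
by apply/eqP; rewrite fmP fmM fmU.
Qed.

(** Words span [B], so identities that are linear in [b] can be proved letter by
    letter, from the left, without a normal form. *)
Lemma BK_ind (P : B -> Prop) : P 1 ->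
    (forall c b b', P b -> P b' -> P (c *: b + b')) ->
    (forall b, P b -> [/\ P (x1 alpha * b), P (x2 alpha * b),
                          P (y1 alpha * b) & P (y2 alpha * b)]) ->
  forall b, P b.
Proof.
move=> P1 PD PM b; have [g <-] := qalg_pi_surj b.
elim/malg_ind: g => [|c w g IH].
  by rewrite rmorph0 -[0](addNr 1) -scaleN1r; apply: PD.
suff Pw : P (qalg_pi (BKquotient alpha) (<< w >> : free)).
  by rewrite linearP; apply: PD.
rewrite BKquotient_word.
elim: (w : seq _) => [|i s IHs]; first by rewrite big_nil.
rewrite big_cons; have [Px1 Px2 Py1 Py2] := PM _ IHs.
by case: (ord4P i) => ->.
Qed.

Section Representation.
Variable V : lmodType K.
Variables X1 X2 Y1 Y2 : V -> V.
Hypothesis lX1 : linear X1.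
Hypothesis lX2 : linear X2.
Hypothesis lY1 : linear Y1.
Hypothesis lY2 : linear Y2.
Hypothesis X21 : forall v, X2 (X1 v) = - X1 (X2 v).
Hypothesis Y21 : forall v, Y2 (Y1 v) = - Y1 (Y2 v).
Hypothesis Y1X1 : forall v, Y1 (X1 v) = X1 (Y1 v).
Hypothesis Y1X2 : forall v, Y1 (X2 v) = X2 (Y2 v).
Hypothesis Y2X1 : forall v, Y2 (X1 v) = X1 (Y2 v).
Hypothesis Y2X2 : forall v, Y2 (X2 v) = alpha *: X2 (Y1 v).

(* The letters of the free algebra are numbered x1, x2, y1, y2. *)
Let op (i : 'I_4) : V -> V := nth id [:: X1; X2; Y1; Y2] i.

Let op_linear i : linear (op i).
Proof. by case: (ord4P i) => ->; rewrite /op inordK. Qed.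
Arguments op_linear : clear implicits.

(* This is proved over an abstract algebra [R]: in the concrete free algebra,
   rewriting would unfold its ring operations. *)
Let relator_act (R : algType K) (f : R -> V -> V) (a1 a2 b1 b2 r : R) :
    (forall g h v, f (g + h) v = f g v + f h v) ->
    (forall c g v, f (c *: g) v = c *: f g v) ->
    (forall g h v, f (g * h) v = f g (f h v)) ->
    f a1 =1 X1 -> f a2 =1 X2 -> f b1 =1 Y1 -> f b2 =1 Y2 ->
  r \in BK_relators alpha a1 a2 b1 b2 -> forall v, f r v = 0.
Proof.
move=> fD fZ fM a1E a2E b1E b2E.
have fN g v : f (- g) v = - f g v by rewrite -[- g]scaleN1r fZ scaleN1r.
rewrite !in_cons in_nil orbF => /or4P[|||/or3P[]] /eqP -> v;
  rewrite fD ?fN ?fZ !fM !(a1E, a2E, b1E, b2E).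
- by rewrite X21 addNr.
- by rewrite Y21 addNr.
- by rewrite Y1X1 subrr.
- by rewrite Y1X2 subrr.
- by rewrite Y2X1 subrr.
- by rewrite Y2X2 subrr.
Qed.

Let word_act (w : {fmonom 'I_4}) (v : V) := foldr op v (w : seq 'I_4).
Let free_act (g : free) (v : V) : V := malg_extend (word_act^~ v) g.

Let free_act_linear v : linear (free_act^~ v).
Proof. exact: malg_extend_linear. Qed.
Arguments free_act_linear : clear implicits.

Let free_actD g h v : free_act (g + h) v = free_act g v + free_act h v.
Proof. exact: (linear_add (free_act_linear v)). Qed.

Let free_actZ c g v : free_act (c *: g) v = c *: free_act g v.
Proof. exact: (linear_scale (free_act_linear v)). Qed.

Let free_act0 v : free_act 0 v = 0.
Proof. exact: (linear_zero (free_act_linear v)). Qed.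

Let free_actU w v : free_act << w >> v = word_act w v.
Proof. exact: malg_extendU. Qed.

Let free_act_linear_r g : linear (free_act g).
Proof.
move=> c u v; elim/malg_ind: g => [|e w g IH].
  by rewrite !free_act0 scaler0 addr0.
rewrite !free_actD !free_actZ !free_actU IH scalerDr addrACA; congr (_ + _).
rewrite scalerA mulrC -scalerA -scalerDr; congr (_ *: _).
by rewrite /word_act; elim: (w : seq _) => //= i s ->; exact: op_linear.
Qed.
Arguments free_act_linear_r : clear implicits.

Let free_actM g h v : free_act (g * h) v = free_act g (free_act h v).
Proof.
elim/malg_ind: g => [|c w g IH]; first by rewrite mul0r !free_act0.
rewrite mulrDl -scalerAl (free_actD (c *: _)) (free_actZ c).
rewrite (free_actD (c *: _) g) (free_actZ c).
congr (_ *: _ + _); last exact: IH.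
elim/malg_ind: h {IH} => [|e u h IH].
  by rewrite mulr0 !free_act0 (linear_zero (free_act_linear_r _)).
rewrite mulrDr -scalerAr (free_actD (e *: _)) (free_actZ e).
rewrite (free_actD (e *: _) h) (free_actZ e) (free_act_linear_r << w >>).
congr (_ *: _ + _); last exact: IH.
rewrite malgM_def fgmulUU mulr1 !free_actU.
by rewrite /word_act fmM foldr_cat.
Qed.

Let free_act_ideal g v :
  in_relideal (BK_relators alpha (letter K (inord 0)) (letter K (inord 1))
                 (letter K (inord 2)) (letter K (inord 3))) g ->
  free_act g v = 0.
Proof.
have letterE i : free_act (letter K i) =1 op i.
  by move=> u; rewrite free_actU /word_act fmU.
have letter0 : free_act (letter K (inord 0)) =1 X1.
  by move=> u; rewrite letterE /op inordK.
have letter1 : free_act (letter K (inord 1)) =1 X2.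
  by move=> u; rewrite letterE /op inordK.
have letter2 : free_act (letter K (inord 2)) =1 Y1.
  by move=> u; rewrite letterE /op inordK.
have letter3 : free_act (letter K (inord 3)) =1 Y2.
  by move=> u; rewrite letterE /op inordK.
move=> [s sP ->]; elim: s sP => [|t s IH] /=; first by rewrite big_nil free_act0.
case/andP=> tP /IH {}IH; rewrite big_cons free_actD IH addr0 !free_actM.
rewrite (relator_act free_actD free_actZ free_actM
           letter0 letter1 letter2 letter3 tP).
exact: (linear_zero (free_act_linear_r _)).
Qed.

(** The universal property of the presentation, for modules. Words act by
    composition of operators, the free algebra by linearity, and the relators,
    hence the ideal they generate, act by zero. *)
Lemma BK_representation : exists act : B -> V -> V,
  [/\ forall v, linear (act^~ v), forall v, act 1 v = v,
      forall b b' v, act (b * b') v = act b (act b' v)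
    & [/\ act (x1 alpha) =1 X1, act (x2 alpha) =1 X2,
          act (y1 alpha) =1 Y1 & act (y2 alpha) =1 Y2]].
Proof.
have [r rK] := choice (@qalg_pi_surj _ _ _ (BKquotient alpha)).
have actE g v : free_act (r (qalg_pi (BKquotient alpha) g)) v = free_act g v.
  rewrite -[X in free_act X](subrK g) free_actD free_act_ideal ?add0r //.
  apply/(qalg_pi_eq0 (BKquotient alpha)); apply/eqP.
  by rewrite rmorphB subr_eq0; apply/eqP; exact: rK.
exists (fun b => free_act (r b)); split.
- move=> v c b b'; rewrite -[b in LHS]rK -[b' in LHS]rK -linearP actE.
  by rewrite free_actD free_actZ.
- move=> v; rewrite -(rmorph1 (qalg_pi (BKquotient alpha))) actE.
  rewrite (_ : 1 = << mone >>) // free_actU /word_act.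
  by rewrite fm1.
- move=> b b' v; rewrite -[b in LHS]rK -[b' in LHS]rK -rmorphM actE.
  exact: free_actM.
have genE i v : free_act (r (BKgen alpha i)) v = op i v.
  by rewrite actE free_actU /word_act fmU.
by split=> v; rewrite genE /op inordK.
Qed.
End Representation.
End Presentation.

(** * The monomial basis of B *)

Section PBW.
Variables (K : fieldType) (alpha : K).
Hypothesis alpha_neq0 : alpha != 0.
Local Notation B := (BK alpha).
Local Notation x1 := (x1 alpha).
Local Notation x2 := (x2 alpha).
Local Notation y1 := (y1 alpha).
Local Notation y2 := (y2 alpha).

Let x21 : x2 * x1 = - (x1 * x2). Proof. by have [] := BK_relations alpha. Qed.
Let y21 : y2 * y1 = - (y1 * y2). Proof. by have [] := BK_relations alpha. Qed.
Let y1x1 : y1 * x1 = x1 * y1. Proof. by have [_ _ []] := BK_relations alpha. Qed.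
Let y1x2 : y1 * x2 = x2 * y2. Proof. by have [_ _ []] := BK_relations alpha. Qed.
Let y2x1 : y2 * x1 = x1 * y2. Proof. by have [_ _ []] := BK_relations alpha. Qed.
Let y2x2 : y2 * x2 = alpha *: (x2 * y1).
Proof. by have [_ _ []] := BK_relations alpha. Qed.
Let x2y1 : x2 * y1 = alpha^-1 *: (y2 * x2).
Proof. by rewrite y2x2 scalerA (mulVf alpha_neq0) scale1r. Qed.

Definition pbw_index : choiceType := (nat * nat * nat * nat)%type.
Definition pbw_space : lmodType K := {malg K[pbw_index]}.
Local Notation V := pbw_space.

(** The formal monomial y1^c y2^d x1^a x2^b. With the y's in front, left
    multiplication by y1 and y2 does not involve alpha. *)
Definition pbw_vector (c d a b : nat) : pbw_space :=
  << ((c, d, a, b) : pbw_index) >>.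

Definition pbw_extend (V : lmodType K) (f : nat -> nat -> nat -> nat -> V) :
    pbw_space -> V :=
  malg_extend (fun m : pbw_index => let: (c, d, a, b) := m in f c d a b).

Lemma pbw_extend_linear V f : linear (@pbw_extend V f).
Proof. exact: malg_extend_linear. Qed.

Lemma pbw_extendE V f c d a b :
  @pbw_extend V f (pbw_vector c d a b) = f c d a b.
Proof. exact: malg_extendU. Qed.

Lemma pbw_linear_eq (V : lmodType K) (f g : pbw_space -> V) :
    linear f -> linear g ->
    (forall c d a b, f (pbw_vector c d a b) = g (pbw_vector c d a b)) ->
  f =1 g.
Proof.
move=> lf lg fg v; elim/malg_ind: v => [|s [[[c d] a] b] v IH].
  by rewrite (linear_zero lf) (linear_zero lg).
by rewrite lf lg IH; congr (_ *: _ + _); exact: fg.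
Qed.

(** The straightening rules. For x2: moving it past y1^c y2^d exchanges the two
    y's and costs alpha^-c, reordering y2^c y1^d costs the sign (-1)^(c d), and
    moving x2 past x1^a costs (-1)^a. *)
Definition pbw_x1 := pbw_extend (fun c d a b => pbw_vector c d a.+1 b).
Definition pbw_x2 := pbw_extend (fun c d a b =>
  ((-1) ^+ a * (-1) ^+ (c * d) * alpha ^- c) *: pbw_vector d c a b.+1).
Definition pbw_y1 := pbw_extend (fun c d a b => pbw_vector c.+1 d a b).
Definition pbw_y2 := pbw_extend (fun c d a b =>
  (-1) ^+ c *: pbw_vector c d.+1 a b).

Lemma pbw_x1E c d a b : pbw_x1 (pbw_vector c d a b) = pbw_vector c d a.+1 b.
Proof. exact: pbw_extendE. Qed.

Lemma pbw_x2E c d a b : pbw_x2 (pbw_vector c d a b) =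
  ((-1) ^+ a * (-1) ^+ (c * d) * alpha ^- c) *: pbw_vector d c a b.+1.
Proof. exact: pbw_extendE. Qed.

Lemma pbw_y1E c d a b : pbw_y1 (pbw_vector c d a b) = pbw_vector c.+1 d a b.
Proof. exact: pbw_extendE. Qed.

Lemma pbw_y2E c d a b : pbw_y2 (pbw_vector c d a b) =
  (-1) ^+ c *: pbw_vector c d.+1 a b.
Proof. exact: pbw_extendE. Qed.

Definition pbwE := (pbw_x1E, pbw_x2E, pbw_y1E, pbw_y2E).

Let lx1 : linear pbw_x1. Proof. exact: pbw_extend_linear. Qed.
Let lx2 : linear pbw_x2. Proof. exact: pbw_extend_linear. Qed.
Let ly1 : linear pbw_y1. Proof. exact: pbw_extend_linear. Qed.
Let ly2 : linear pbw_y2. Proof. exact: pbw_extend_linear. Qed.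

(** On a basis vector both sides of each relation are multiples of the same
    vector, so the six relations become identities between scalars. *)
Lemma pbw_representation : exists act : B -> pbw_space -> pbw_space,
  [/\ forall v, linear (act^~ v), forall v, act 1 v = v,
      forall b b' v, act (b * b') v = act b (act b' v)
    & [/\ act x1 =1 pbw_x1, act x2 =1 pbw_x2,
          act y1 =1 pbw_y1 & act y2 =1 pbw_y2]].
Proof.
apply: BK_representation.
- exact: lx1.
- exact: lx2.
- exact: ly1.
- exact: ly2.
- apply: pbw_linear_eq => [||c d a b].
    exact: (linear_compose lx1 lx2).
    exact: (linear_negate (linear_compose lx2 lx1)).
  by rewrite !(pbwE, linear_scale lx1) exprS !mulN1r !mulNr scaleNr.
- apply: pbw_linear_eq => [||c d a b].
    exact: (linear_compose ly1 ly2).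
    exact: (linear_negate (linear_compose ly2 ly1)).
  by rewrite !(pbwE, linear_scale ly1) exprS !mulN1r scaleNr.
- apply: pbw_linear_eq => [||c d a b].
    exact: (linear_compose lx1 ly1).
    exact: (linear_compose ly1 lx1).
  by rewrite !pbwE.
- apply: pbw_linear_eq => [||c d a b].
    exact: (linear_compose lx2 ly1).
    exact: (linear_compose ly2 lx2).
  rewrite !(pbwE, linear_scale ly1, linear_scale lx2) scalerA.
  congr (_ *: _); rewrite mulnS exprD; ring: (sqrr_sign K c).
- apply: pbw_linear_eq => [||c d a b].
    exact: (linear_compose lx1 ly2).
    exact: (linear_compose ly2 lx1).
  by rewrite !(pbwE, linear_scale lx1).
- apply: pbw_linear_eq => [||c d a b].
    exact: (linear_compose lx2 ly2).
    exact: (linear_multiple (linear_compose ly1 lx2) _).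
  rewrite !(pbwE, linear_scale ly2) !scalerA.
  congr (_ *: _); rewrite mulSn exprD exprS invfM.
  by field; rewrite ?expf_neq0 ?alpha_neq0.
Qed.

Definition pbw_monomial : pbw_space -> B :=
  pbw_extend (fun c d a b => y1 ^+ c * y2 ^+ d * x1 ^+ a * x2 ^+ b).

Let lmono : linear pbw_monomial. Proof. exact: pbw_extend_linear. Qed.

Lemma pbw_monomialE c d a b : pbw_monomial (pbw_vector c d a b) =
  y1 ^+ c * y2 ^+ d * x1 ^+ a * x2 ^+ b.
Proof. exact: pbw_extendE. Qed.

Lemma mul_power_scale (u v w : B) (s : K) n :
  u * v = s *: (w * u) -> u * v ^+ n = s ^+ n *: (w ^+ n * u).
Proof.
move=> uv; elim: n => [|n IH]; first by rewrite !expr0 mulr1 mul1r scale1r.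
rewrite exprS mulrA uv -scalerAl -mulrA IH -scalerAr scalerA mulrA.
by rewrite -exprS -[w * _]exprS.
Qed.

(** The straightening rules hold in [B] itself: the operators on formal monomials
    mirror left multiplication, for x1 here and for the other generators below.
    This is why the monomials span. *)
Lemma pbw_monomial_x1 v : pbw_monomial (pbw_x1 v) = x1 * pbw_monomial v.
Proof.
move: v; apply: pbw_linear_eq => [||c d a b].
- exact: (linear_compose lx1 lmono).
- by move=> s u v; rewrite lmono mulrDr scalerAr.
rewrite !(pbwE, pbw_monomialE).
have E : GRing.comm x1 (y1 ^+ c * y2 ^+ d).
  apply: GRing.commrM; apply: GRing.commrX; first exact: esym y1x1.
  exact: esym y2x1.
by rewrite exprS !mulrA -E !mulrA.
Qed.

Lemma pbw_monomial_y1 v : pbw_monomial (pbw_y1 v) = y1 * pbw_monomial v.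
Proof.
move: v; apply: pbw_linear_eq => [||c d a b].
- exact: (linear_compose ly1 lmono).
- by move=> s u v; rewrite lmono mulrDr scalerAr.
by rewrite !(pbwE, pbw_monomialE) exprS !mulrA.
Qed.

Lemma pbw_monomial_y2 v : pbw_monomial (pbw_y2 v) = y2 * pbw_monomial v.
Proof.
move: v; apply: pbw_linear_eq => [||c d a b].
- exact: (linear_compose ly2 lmono).
- by move=> s u v; rewrite lmono mulrDr scalerAr.
rewrite !(pbwE, pbw_monomialE, linear_scale lmono) exprS !mulrA.
have -> : y2 * y1 ^+ c = (-1) ^+ c *: (y1 ^+ c * y2).
  by apply: mul_power_scale; rewrite scaleN1r.
by rewrite !scalerAl.
Qed.

Lemma pbw_monomial_x2 v : pbw_monomial (pbw_x2 v) = x2 * pbw_monomial v.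
Proof.
move: v; apply: pbw_linear_eq => [||c d a b].
- exact: (linear_compose lx2 lmono).
- by move=> s u v; rewrite lmono mulrDr scalerAr.
rewrite !(pbwE, pbw_monomialE, linear_scale lmono) !mulrA.
have x2_y1 : x2 * y1 ^+ c = alpha ^- c *: (y2 ^+ c * x2).
  by rewrite -exprVn; exact: mul_power_scale.
have x2_y2 : x2 * y2 ^+ d = y1 ^+ d * x2.
  rewrite (@mul_power_scale x2 y2 y1 1 d); first by rewrite expr1n scale1r.
  by rewrite scale1r y1x2.
have x2_x1 : x2 * x1 ^+ a = (-1) ^+ a *: (x1 ^+ a * x2).
  by apply: mul_power_scale; rewrite scaleN1r.
have y2_y1 : y2 ^+ c * y1 ^+ d = (-1) ^+ (c * d) *: (y1 ^+ d * y2 ^+ c).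
  elim: (c) => [|n IH]; first by rewrite mul1r mulr1 scale1r.
  rewrite exprS -mulrA IH -scalerAr [y2 * (_ * _)]mulrA.
  rewrite (@mul_power_scale y2 y1 y1 (-1) d) ?scaleN1r //.
  by rewrite -scalerAl scalerA -mulrA -exprD -mulSnr.
rewrite x2_y1 -!scalerAl -[y2 ^+ c * x2 * _]mulrA x2_y2 mulrA y2_y1.
rewrite -!scalerAl -[y1 ^+ d * y2 ^+ c * x2 * _]mulrA x2_x1.
rewrite -scalerAr -!scalerAl !scalerA exprS !mulrA.
by congr (_ *: _); ring.
Qed.

(** The monomials form a basis. The coordinates of [b] are its action on the
    formal monomial 1. Going back to [B] recovers [b] because the action mirrors
    left multiplication, and building a monomial letter by letter from 1 gives
    the corresponding formal monomial. *)
Lemma pbw_coordinates : exists co : B -> V,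
  [/\ linear co, cancel co pbw_monomial, cancel pbw_monomial co,
      co 1 = pbw_vector 0 0 0 0
    & [/\ forall b, co (x1 * b) = pbw_x1 (co b),
          forall b, co (x2 * b) = pbw_x2 (co b),
          forall b, co (y1 * b) = pbw_y1 (co b)
        & forall b, co (y2 * b) = pbw_y2 (co b)]].
Proof.
have [act [act_lin act1 actM [act_x1 act_x2 act_y1 act_y2]]] :=
  pbw_representation.
pose e0 := pbw_vector 0 0 0 0; pose co b := act b e0.
have lco : linear co by exact: act_lin.
have co_x1 b : co (x1 * b) = pbw_x1 (co b) by rewrite /co actM act_x1.
have co_x2 b : co (x2 * b) = pbw_x2 (co b) by rewrite /co actM act_x2.
have co_y1 b : co (y1 * b) = pbw_y1 (co b) by rewrite /co actM act_y1.
have co_y2 b : co (y2 * b) = pbw_y2 (co b) by rewrite /co actM act_y2.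
have coK : cancel co pbw_monomial.
  elim/BK_ind => [|s b b' IH IH'|b IH].
  - by rewrite /co act1 pbw_monomialE !mulr1.
  - by rewrite lco lmono IH IH'.
  - split.
    + by rewrite co_x1 pbw_monomial_x1 IH.
    + by rewrite co_x2 pbw_monomial_x2 IH.
    + by rewrite co_y1 pbw_monomial_y1 IH.
    + by rewrite co_y2 pbw_monomial_y2 IH.
exists co; split=> //; last by rewrite /co act1.
move=> v; apply: (pbw_linear_eq (f := fun v => co (pbw_monomial v))
                                (g := id)) => [|//|c d a b].
  exact: (linear_compose lmono lco).
rewrite pbw_monomialE -!mulrA.
have co_x2n : co (x2 ^+ b) = pbw_vector 0 0 0 b.
  elim: b => [|n IH]; first by rewrite /co act1.
  by rewrite exprS co_x2 IH pbwE !mul1r invr1 scale1r.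
have co_x1n : co (x1 ^+ a * x2 ^+ b) = pbw_vector 0 0 a b.
  elim: a => [|n IH]; first by rewrite mul1r.
  by rewrite exprS -mulrA co_x1 IH pbwE.
have co_y2n : co (y2 ^+ d * (x1 ^+ a * x2 ^+ b)) = pbw_vector 0 d a b.
  elim: d => [|n IH]; first by rewrite mul1r.
  by rewrite exprS -mulrA co_y2 IH pbwE scale1r.
elim: c => [|n IH]; first by rewrite mul1r.
by rewrite exprS -mulrA co_y1 IH pbwE.
Qed.

(** * Left multiplication by y1 and y2 *)

(** Quotient and remainder of left division. The sign in [pbw_divy2] undoes
    y2 y1^c = (-1)^c y1^c y2. *)
Definition pbw_divy1 := pbw_extend (fun c d a b =>
  if c is c'.+1 then pbw_vector c' d a b else 0).
Definition pbw_divy2 := pbw_extend (fun c d a b =>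
  if d is d'.+1 then (-1) ^+ c *: pbw_vector c d' a b else 0).
Definition pbw_mody2 := pbw_extend (fun c d a b =>
  if d is _.+1 then 0 else pbw_vector c d a b).

Let ldiv1 : linear pbw_divy1. Proof. exact: pbw_extend_linear. Qed.
Let ldiv2 : linear pbw_divy2. Proof. exact: pbw_extend_linear. Qed.
Let lmod2 : linear pbw_mody2. Proof. exact: pbw_extend_linear. Qed.

Lemma pbw_divy1K (v : V) : pbw_divy1 (pbw_y1 v) = v.
Proof.
move: v; apply: (pbw_linear_eq (g := id)) => [|//|c d a b].
  exact: (linear_compose ly1 ldiv1).
by rewrite pbwE [LHS]pbw_extendE.
Qed.

Lemma pbw_divy2K (v : V) : pbw_divy2 (pbw_y2 v) = v.
Proof.
move: v; apply: (pbw_linear_eq (g := id)) => [|//|c d a b].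
  exact: (linear_compose ly2 ldiv2).
rewrite pbwE (linear_scale ldiv2) [pbw_divy2 _]pbw_extendE.
by rewrite scalerA -exprD addnn -signr_odd odd_double scale1r.
Qed.

Lemma pbw_divy2_y1 (v : V) : pbw_divy2 (pbw_y1 v) = - pbw_y1 (pbw_divy2 v).
Proof.
move: v; apply: pbw_linear_eq => [||c d a b].
- exact: (linear_compose ly1 ldiv2).
- exact: (linear_negate (linear_compose ldiv2 ly1)).
rewrite pbwE ![pbw_divy2 _]pbw_extendE; case: d => [|d].
  by rewrite (linear_zero ly1) oppr0.
by rewrite (linear_scale ly1) pbwE exprS mulN1r scaleNr.
Qed.

Lemma pbw_mody2_y1 (v : V) : pbw_mody2 (pbw_y1 v) = pbw_y1 (pbw_mody2 v).
Proof.
move: v; apply: pbw_linear_eq => [||c d a b].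
- exact: (linear_compose ly1 lmod2).
- exact: (linear_compose lmod2 ly1).
rewrite pbwE ![pbw_mody2 _]pbw_extendE; case: d => [|d]; first by rewrite pbwE.
by rewrite (linear_zero ly1).
Qed.

Lemma pbw_mody2_y2 (v : V) : pbw_mody2 (pbw_y2 v) = 0.
Proof.
move: v; apply: (pbw_linear_eq (g := fun=> 0)) => [||c d a b].
- exact: (linear_compose ly2 lmod2).
- by move=> s u v; rewrite scaler0 addr0.
by rewrite pbwE (linear_scale lmod2) [pbw_mody2 _]pbw_extendE scaler0.
Qed.

Lemma pbw_divy2_eq (v : V) : v = pbw_y2 (pbw_divy2 v) + pbw_mody2 v.
Proof.
move: v; apply: (pbw_linear_eq (f := id)) => [//||c d a b].
  move=> s u v; rewrite ldiv2 ly2 lmod2 scalerDr addrACA //.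
rewrite [pbw_divy2 _]pbw_extendE [pbw_mody2 _]pbw_extendE; case: d => [|d].
  by rewrite (linear_zero ly2) add0r.
rewrite (linear_scale ly2) pbwE addr0 scalerA.
by rewrite -exprD addnn -signr_odd odd_double scale1r.
Qed.

Lemma BK_y1_regular (w : B) : y1 * w = 0 -> w = 0.
Proof.
have [co [lco coK _ _ [_ _ co_y1 _]]] := pbw_coordinates.
move=> /(congr1 co); rewrite co_y1 (linear_zero lco) => /(congr1 pbw_divy1).
rewrite pbw_divy1K (linear_zero ldiv1) => cow0.
by rewrite -[w]coK cow0 (linear_zero lmono).
Qed.

Lemma BK_y2_regular (w : B) : y2 * w = 0 -> w = 0.
Proof.
have [co [lco coK _ _ [_ _ _ co_y2]]] := pbw_coordinates.
move=> /(congr1 co); rewrite co_y2 (linear_zero lco) => /(congr1 pbw_divy2).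
rewrite pbw_divy2K (linear_zero ldiv2) => cow0.
by rewrite -[w]coK cow0 (linear_zero lmono).
Qed.

(** Exactness in the middle of the complex. Reducing y1 u + y2 v = 0 modulo y2
    and dividing by y1 shows that y2 divides u; dividing the same equation by y2
    then determines v. *)
Lemma BK_y_syzygy (u v : B) : y1 * u + y2 * v = 0 ->
  exists w, u = y2 * w /\ v = y1 * w.
Proof.
have [co [lco coK _ _ [_ _ co_y1 co_y2]]] := pbw_coordinates.
move=> /(congr1 co); rewrite (linear_add lco) co_y1 co_y2 (linear_zero lco) => uv0.
have mod_u : pbw_mody2 (co u) = 0.
  have := congr1 pbw_mody2 uv0; rewrite (linear_add lmod2) pbw_mody2_y1.
  rewrite pbw_mody2_y2 addr0 (linear_zero lmod2) => /(congr1 pbw_divy1).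
  by rewrite pbw_divy1K (linear_zero ldiv1).
have co_v : co v = pbw_y1 (pbw_divy2 (co u)).
  have := congr1 pbw_divy2 uv0; rewrite (linear_add ldiv2) pbw_divy2_y1.
  by rewrite pbw_divy2K (linear_zero ldiv2) addrC => /eqP; rewrite subr_eq0 => /eqP.
exists (pbw_monomial (pbw_divy2 (co u))); rewrite -pbw_monomial_y1 -pbw_monomial_y2.
by rewrite -co_v coK -[u in LHS]coK {1}[co u]pbw_divy2_eq mod_u addr0.
Qed.

(** * The grading of B *)

(** The projection to degree [j] in the monomial basis. The index is an integer,
    and a negative one gives zero, so that shifting [j] by one needs no case
    distinction in [pbw_component_shift]. *)
Definition pbw_component (j : int) := pbw_extend (fun c d a b =>
  if Posz (c + d + a + b) == j then pbw_vector c d a b else 0).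

Let lcomp j : linear (pbw_component j). Proof. exact: pbw_extend_linear. Qed.
Arguments lcomp : clear implicits.

Lemma pbw_component_shift (f : V -> V) (j : int) v :
    linear f ->
    (forall c d a b k, pbw_component k (f (pbw_vector c d a b)) =
       if Posz (c + d + a + b).+1 == k then f (pbw_vector c d a b) else 0) ->
  pbw_component j (f v) = f (pbw_component (j - 1) v).
Proof.
move=> lf fdeg; move: v; apply: pbw_linear_eq => [||c d a b].
- exact: (linear_compose lf (lcomp j)).
- exact: (linear_compose (lcomp _) lf).
rewrite fdeg [pbw_component (j - 1) _]pbw_extendE.
rewrite -[(_ + b)%N.+1]addn1 PoszD -(inj_eq (addIr (-1))) addrK.
by case: ifP => // _; rewrite (linear_zero lf).
Qed.

Lemma BKdeg_word (s : seq 'I_4) :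
  BKdeg (size s) (\prod_(i <- s) BKgen alpha i).
Proof.
exists (fun w => (w == in_tuple s)%:R).
rewrite [RHS](bigD1 (in_tuple s)) //= eqxx scale1r.
rewrite [X in _ + X]big1 ?addr0 // => w /negPf ->.
by rewrite scale0r.
Qed.

Lemma BKdeg_linear j (c : K) (u v : B) :
  BKdeg j u -> BKdeg j v -> BKdeg j (c *: u + v).
Proof.
case: j => [n|n] /=; last by move=> -> ->; rewrite scaler0 addr0.
move=> [f ->] [g ->]; exists (fun w => c * f w + g w).
rewrite scaler_sumr -big_split; apply: eq_bigr => w _.
by rewrite scalerDl scalerA.
Qed.

Lemma BKdeg0 j : BKdeg j (0 : B).
Proof.
case: j => [n|n] //=; exists (fun=> 0); rewrite big1 // => w _.
by rewrite scale0r.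
Qed.

Lemma BKdegZ j (c : K) (u : B) : BKdeg j u -> BKdeg j (c *: u).
Proof. by move=> uj; rewrite -[_ *: _]addr0; apply: BKdeg_linear (BKdeg0 j). Qed.

Lemma BKdegD j (u v : B) : BKdeg j u -> BKdeg j v -> BKdeg j (u + v).
Proof. by rewrite -{2}[u]scale1r; exact: BKdeg_linear. Qed.

(** Homogeneous elements are linear combinations of words, so a property that is
    linear in each degree only has to be checked on words. *)
Lemma BKdeg_ind (P : int -> B -> Prop) :
    (forall j, P j 0) ->
    (forall j c u v, P j u -> P j v -> P j (c *: u + v)) ->
    (forall s : seq 'I_4, P (size s) (\prod_(i <- s) BKgen alpha i)) ->
  forall j b, BKdeg j b -> P j b.
Proof.
move=> P0 PD Pw [n|n] b /= => [[f ->]|-> //].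
elim: (index_enum _) => [|w r IH]; first by rewrite big_nil.
by rewrite big_cons; apply: PD IH; rewrite -{1}(size_tuple w).
Qed.

Lemma BKdegM i j (u v : B) : BKdeg i u -> BKdeg j v -> BKdeg (i + j) (u * v).
Proof.
move=> ui; move: i u ui j v; apply: BKdeg_ind.
- by move=> i j v _; rewrite mul0r; exact: BKdeg0.
- move=> i c u u' IH IH' j v vj; rewrite mulrDl -scalerAl.
  by apply: BKdeg_linear; [exact: IH|exact: IH'].
move=> s; apply: BKdeg_ind.
- by move=> j; rewrite mulr0; exact: BKdeg0.
- by move=> j c v v' IH IH'; rewrite mulrDr -scalerAr; apply: BKdeg_linear.
by move=> t; rewrite -big_cat -PoszD -size_cat; exact: BKdeg_word.
Qed.

Lemma BKdeg_gen i : BKdeg 1 (BKgen alpha i).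
Proof. by have := BKdeg_word [:: i]; rewrite big_seq1. Qed.

Lemma BKdeg1 : BKdeg 0 (1 : B).
Proof. by have := BKdeg_word [::]; rewrite big_nil. Qed.

Lemma BKdegX (n : nat) i : BKdeg n (BKgen alpha i ^+ n).
Proof.
elim: n => [|n IH]; first exact: BKdeg1.
by rewrite exprS -add1n PoszD; apply: BKdegM IH; exact: BKdeg_gen.
Qed.

Lemma BKdeg_monomial c d a b :
  BKdeg (c + d + a + b)%N (pbw_monomial (pbw_vector c d a b)).
Proof.
rewrite pbw_monomialE !PoszD.
by do 3![apply: BKdegM; last exact: BKdegX]; exact: BKdegX.
Qed.

(** The span of the words of length n is the span of the monomials of degree n,
    because each straightening rule turns a monomial into a multiple of one
    whose degree is larger by one. So the basis provides the projections. *)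
Lemma BK_is_graded : is_graded (@BKdeg K alpha).
Proof.
have [co [lco coK monoK co1 [co_x1 co_x2 co_y1 co_y2]]] := pbw_coordinates.
split=> [||j u uj|P P0 PD b|].
- exact: BKdeg0.
- exact: BKdegD.
- by rewrite -scaleN1r; exact: BKdegZ.
- rewrite -[b]coK; elim/malg_ind: (co b) => [|s [[[c d] a] e] v IH].
    by rewrite (linear_zero lmono).
  rewrite lmono; apply: (PD (c + d + a + e)%N) IH.
  by apply: BKdegZ; exact: BKdeg_monomial.
have word_component s j : pbw_component j (co (\prod_(i <- s) BKgen alpha i)) =
    if Posz (size s) == j then co (\prod_(i <- s) BKgen alpha i) else 0.
  elim: s j => [|i s IH] j.
    by rewrite big_nil co1 [LHS]pbw_extendE.
  have step f : (forall b, co (BKgen alpha i * b) = f (co b)) -> linear f ->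
      (forall c d a b k, pbw_component k (f (pbw_vector c d a b)) =
        if Posz (c + d + a + b).+1 == k then f (pbw_vector c d a b) else 0) ->
      pbw_component j (co (\prod_(i <- i :: s) BKgen alpha i)) =
      if Posz (size (i :: s)) == j
      then co (\prod_(i <- i :: s) BKgen alpha i) else 0.
    move=> co_f lf fdeg; rewrite big_cons co_f pbw_component_shift // IH /=.
    rewrite -[(size s).+1]addn1 PoszD -[in RHS](inj_eq (addIr (-1))) addrK.
    by case: ifP => // _; rewrite (linear_zero lf).
  have ifZ (t : K) (q : bool) (v : V) :
      t *: (if q then v else 0) = if q then t *: v else 0.
    by case: q; rewrite ?scaler0.
  case: (ord4P i) step => -> step.
  - apply: (step _ co_x1) => // c d a b k.
    by rewrite pbwE [LHS]pbw_extendE addnS.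
  - apply: (step _ co_x2) => // c d a b k.
    rewrite pbwE (linear_scale (lcomp k)) [pbw_component _ _]pbw_extendE ifZ.
    by rewrite addnS (addnC d).
  - apply: (step _ co_y1) => // c d a b k.
    by rewrite pbwE [LHS]pbw_extendE !addSn.
  - apply: (step _ co_y2) => // c d a b k.
    rewrite pbwE (linear_scale (lcomp k)) [pbw_component _ _]pbw_extendE ifZ.
    by rewrite addnS !addSn.
exists (fun j b => pbw_monomial (pbw_component j (co b))); split.
- move=> j u v; rewrite (linear_add lco) (linear_add (lcomp j)).
  exact: (linear_add lmono).
- apply: BKdeg_ind => [j|j s u v IH IH'|s].
  + by rewrite (linear_zero lco) (linear_zero (lcomp j)) (linear_zero lmono).
  + by rewrite lco (lcomp j) lmono IH IH'.
  + by rewrite word_component eqxx coK.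
- move=> j; apply: (BKdeg_ind (P := fun k u =>
    k != j -> pbw_monomial (pbw_component j (co u)) = 0)).
  + by move=> k _; rewrite (linear_zero lco) (linear_zero (lcomp j)) (linear_zero lmono).
  + move=> k s u v IH IH' kj.
    by rewrite lco (lcomp j) lmono IH // IH' // scaler0 addr0.
  + by move=> s /negPf sj; rewrite word_component sj (linear_zero lmono).
Qed.

Lemma BK_connected_graded : connected_graded (@BKscalar K alpha) (@BKdeg K alpha).
Proof.
split.
- exact: BK_is_graded.
- exact: BKdeg1.
- exact: BKdegM.
- by move=> n a.
- by move=> c; apply: BKdegZ; exact: BKdeg1.
- move=> a [f ->]; exists (\sum_w f w); rewrite /BKscalar scaler_suml.
  by apply: eq_bigr => w _; rewrite tuple0 big_nil.
- by move=> c /eqP; rewrite scaler_eq0 oner_eq0 orbF => /eqP.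
Qed.

Lemma BKc_connected_graded :
  @connected_graded K B^c (@BKscalar K alpha) (@BKdeg K alpha).
Proof.
have [g d1 dM dneg di ds d0] := BK_connected_graded.
split=> // i j a b ai bj; rewrite addrC; exact: dM.
Qed.
End PBW.

(** * The opposite algebra *)

(** For alpha beta = 1 this is the identification of the opposite algebra of
    B_K(alpha) with B_K(beta); it turns a statement about right multiplication
    into one about left multiplication. *)
Record opposite_map (K : fieldType) (alpha beta : K)
    (theta : BK alpha -> BK beta) : Prop := OppositeMap {
  opp_linear : linear theta;
  opp_1 : theta 1 = 1;
  opp_M : forall a b, theta (a * b) = theta b * theta a;
  opp_x1 : theta (x1 alpha) = x1 beta;
  opp_x2 : theta (x2 alpha) = x2 beta;
  opp_y1 : theta (y1 alpha) = y2 beta;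
  opp_y2 : theta (y2 alpha) = y1 beta }.

Lemma opp_0 (K : fieldType) (alpha beta : K) (theta : BK alpha -> BK beta) :
  opposite_map theta -> theta 0 = 0.
Proof. by move=> t; rewrite (linear_zero (opp_linear t)). Qed.

Lemma opp_D (K : fieldType) (alpha beta : K) (theta : BK alpha -> BK beta) u v :
  opposite_map theta -> theta (u + v) = theta u + theta v.
Proof. by move=> t; rewrite (linear_add (opp_linear t)). Qed.

(** Right multiplications by x1, x2, y2, y1 in B_K(beta) satisfy the relations
    of B_K(alpha): reversing y2 x2 = alpha x2 y1 and exchanging the y's gives
    x2 y1 = alpha y2 x2, the relation for 1/alpha. So B_K(alpha) acts on
    B_K(beta), and the map is the action on 1. *)
Lemma opposite_map_exists (K : fieldType) (alpha beta : K) :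
  alpha * beta = 1 -> exists theta : BK alpha -> BK beta, opposite_map theta.
Proof.
move=> ab1; have [x21 y21 [y1x1 y1x2 y2x1 y2x2]] := BK_relations beta.
have lmulr (b : BK beta) : linear (fun v => v * b).
  by move=> c u v; rewrite mulrDl scalerAl.
have [||||||||||act [act_lin act1 actM [act_x1 act_x2 act_y1 act_y2]]] :=
  @BK_representation K alpha (BK beta) (fun v => v * x1 beta)
    (fun v => v * x2 beta) (fun v => v * y2 beta) (fun v => v * y1 beta).
- exact: lmulr.
- exact: lmulr.
- exact: lmulr.
- exact: lmulr.
- by move=> v /=; rewrite -!mulrA x21 mulrN opprK.
- by move=> v /=; rewrite -!mulrA y21 mulrN.
- by move=> v /=; rewrite -!mulrA y2x1.
- by move=> v /=; rewrite -!mulrA y1x2.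
- by move=> v /=; rewrite -!mulrA y1x1.
- by move=> v /=; rewrite -!mulrA y2x2 -scalerAr scalerA ab1 scale1r.
have actE b v : act b v = v * act b 1.
  elim/BK_ind: b v => [v|c b b' IH IH' v|b IH].
  - by rewrite !act1 mulr1.
  - rewrite (act_lin v c b b') (act_lin 1 c b b') [RHS]mulrDr -scalerAr.
    by congr (c *: _ + _); [exact: IH|exact: IH'].
  - split=> v; rewrite !actM.
    + rewrite (act_x1 (act b v)) (act_x1 (act b 1)) (IH v); exact/esym/mulrA.
    + rewrite (act_x2 (act b v)) (act_x2 (act b 1)) (IH v); exact/esym/mulrA.
    + rewrite (act_y1 (act b v)) (act_y1 (act b 1)) (IH v); exact/esym/mulrA.
    + rewrite (act_y2 (act b v)) (act_y2 (act b 1)) (IH v); exact/esym/mulrA.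
exists (act^~ 1); split.
- exact: act_lin.
- exact: act1.
- by move=> a b; rewrite actM; exact: actE.
- by rewrite act_x1; exact: mul1r.
- by rewrite act_x2; exact: mul1r.
- by rewrite act_y1; exact: mul1r.
- by rewrite act_y2; exact: mul1r.
Qed.

Lemma opposite_mapK (K : fieldType) (alpha beta : K)
    (theta : BK alpha -> BK beta) (theta' : BK beta -> BK alpha) :
  opposite_map theta -> opposite_map theta' -> cancel theta theta'.
Proof.
move=> t t'; elim/BK_ind => [|c b b' IH IH'|b IH].
- by rewrite (opp_1 t) (opp_1 t').
- rewrite (opp_linear t c b b') (opp_linear t' c (theta b) (theta b')).
  by rewrite IH IH'.
- split; rewrite (opp_M t) (opp_M t') IH.
  + by rewrite (opp_x1 t) (opp_x1 t').
  + by rewrite (opp_x2 t) (opp_x2 t').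
  + by rewrite (opp_y1 t) (opp_y2 t').
  + by rewrite (opp_y2 t) (opp_y1 t').
Qed.

Section TwoSided.
Variables (K : fieldType) (alpha : K).
Hypothesis alpha_neq0 : alpha != 0.
Local Notation B := (BK alpha).
Local Notation x1 := (x1 alpha).
Local Notation x2 := (x2 alpha).
Local Notation y1 := (y1 alpha).
Local Notation y2 := (y2 alpha).

Lemma BK_opposite :
  exists (theta : B -> BK alpha^-1) (theta' : BK alpha^-1 -> B),
  [/\ opposite_map theta, opposite_map theta', cancel theta theta'
    & cancel theta' theta].
Proof.
have [theta t] := opposite_map_exists (divff alpha_neq0).
have [theta' t'] := opposite_map_exists (mulVf alpha_neq0).
exists theta, theta'; split; [exact: t|exact: t'| |].
- exact: (opposite_mapK t t').
- exact: (opposite_mapK t' t).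
Qed.

Lemma BK_y2_right_regular (w : B) : w * y2 = 0 -> w = 0.
Proof.
have [theta [theta' [t t' tK _]]] := BK_opposite => w0.
have theta_w : theta w = 0.
  apply: (BK_y1_regular (invr_neq0 alpha_neq0)).
  by have := congr1 theta w0; rewrite (opp_M t) (opp_y2 t) (opp_0 t).
apply: (can_inj tK); rewrite theta_w.
exact: esym (opp_0 t).
Qed.

Lemma BK_y_right_syzygy (u v : B) : u * y1 + v * y2 = 0 ->
  exists w, u = w * y2 /\ v = w * y1.
Proof.
have [theta [theta' [t t' tK t'K]]] := BK_opposite => uv0.
have := congr1 theta uv0.
rewrite (opp_D _ _ t) (opp_M t u) (opp_M t v) (opp_y1 t) (opp_y2 t) (opp_0 t).
rewrite addrC => /(BK_y_syzygy (invr_neq0 alpha_neq0))[w [tv tu]].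
exists (theta' w); split.
- apply: (can_inj tK); apply: (etrans tu); apply: esym.
  rewrite (opp_M t (theta' w) y2) (t'K w) (opp_y2 t); reflexivity.
- apply: (can_inj tK); apply: (etrans tv); apply: esym.
  rewrite (opp_M t (theta' w) y1) (t'K w) (opp_y1 t); reflexivity.
Qed.

(** Each of the two one-sided ideals is stable under multiplication by the
    generators on its other side, hence is two-sided, and it contains y1 and
    y2. Division by alpha enters in x2 y1 = (1/alpha) y2 x2. *)
Lemma in_yB_eq_in_By (z : B) : in_yB z <-> in_By z.
Proof.
have [_ _ [y1x1 y1x2 y2x1 y2x2]] := BK_relations alpha.
have x2y1 : x2 * y1 = alpha^-1 *: (y2 * x2).
  by rewrite y2x2 scalerA (mulVf alpha_neq0) scale1r.
have ByM b : forall t : B, in_By t -> in_By (t * b).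
  elim/BK_ind: b => [t|c b b' IH IH' t tP|b IH]; first by rewrite mulr1.
    rewrite mulrDr -scalerAr -mulr_algl; apply: in_ByP; [exact: IH|exact: IH'].
  split=> t [u [v ->]]; rewrite mulrA; apply: IH; rewrite mulrDl -!mulrA.
  - by exists (u * x1), (v * x1); rewrite y1x1 y2x1 !mulrA.
  - exists (alpha *: (v * x2)), (u * x2).
    by rewrite y1x2 y2x2 -scalerAr -scalerAl !mulrA addrC.
  - by exists (u * y1 + v * y2), 0; rewrite mul0r addr0 mulrDl !mulrA.
  - by exists 0, (u * y1 + v * y2); rewrite mul0r add0r mulrDl !mulrA.
have yBM b : forall t : B, in_yB t -> in_yB (b * t).
  elim/BK_ind: b => [t|c b b' IH IH' t tP|b IH]; first by rewrite mul1r.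
    rewrite mulrDl -scalerAl -mulr_algr; apply: in_yBP; [exact: IH|exact: IH'].
  split=> t tP; rewrite -mulrA; case: (IH t tP) => u [v ->]; rewrite mulrDr !mulrA.
  - by exists (x1 * u), (x1 * v); rewrite -y1x1 -y2x1 !mulrA.
  - exists (x2 * v), (alpha^-1 *: (x2 * u)).
    by rewrite x2y1 -y1x2 -scalerAr -scalerAl !mulrA addrC.
  - by exists (y1 * u + y2 * v), 0; rewrite mulr0 addr0 mulrDr !mulrA.
  - by exists 0, (y1 * u + y2 * v); rewrite mulr0 add0r mulrDr !mulrA.
split=> [[u [v ->]]|[u [v ->]]].
- rewrite -[y1 * u]mul1r; apply: in_ByP; apply: ByM.
    by exists 1, 0; rewrite mul1r mul0r addr0.
  by exists 0, 1; rewrite mul1r mul0r add0r.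
- rewrite -[u * y1]mulr1; apply: in_yBP; apply: yBM.
    by exists 1, 0; rewrite mulr1 mulr0 addr0.
  by exists 0, 1; rewrite mulr1 mulr0 add0r.
Qed.

End TwoSided.

(** * The theorem *)

Lemma quotmod_pi_linear (A : nzRingType) (U : lmodType A) (S : submodule U) :
  linear (@quotmod_pi A U S).
Proof. by move=> a u v; rewrite quotmod_piD quotmod_piZ. Qed.

Lemma quotmod_pi_eq0 (A : nzRingType) (U : lmodType A) (S : submodule U) u :
  @quotmod_pi A U S u = 0 <-> S u.
Proof.
rewrite -(linear_zero (quotmod_pi_linear S)) -[u in S u]subr0.
exact: quotmod_piE.
Qed.

Theorem proposition4p4 (K : fieldType) (alpha : K) (alpha_neq0 : alpha != 0) :
  let B := BK alpha in
  let deg : grading B := @BKdeg K alpha in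
  let iota : K -> B := @BKscalar K alpha in
  (* the displayed sequence: its maps are left linear; M_y is B/(B y1 + B y2),
     and y1 B + y2 B = B y1 + B y2 *)
  [/\ forall z : B, in_yB z <-> in_By z,
      @minimal_graded_free_resolution B deg
        (My_left alpha) (@Mydeg_left K alpha)
        (seqF B) (@seqdeg B deg) (@seqd B (@d1y K alpha) (@d2y K alpha))
        (@piMy_left K alpha)
    & let beta := @betti K B iota deg (My_left alpha) (@Mydeg_left K alpha) in
      [/\ beta 0%N 0 1%N, beta 1%N 1 2%N, beta 2%N 2 1%N
        & forall (i : nat) (j : int),
            (i, j) \notin [:: (0%N, 0); (1%N, 1); (2%N, 2)] -> beta i j 0%N]]
  /\
  (* the resolution of the right module M_y = B/(y1 B + y2 B) *)
  [/\ @minimal_graded_free_resolution B^c deg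
        (My alpha) (@Mydeg K alpha)
        (seqF B^c) (@seqdeg B^c deg)
        (@seqd B^c (@d1y_right K alpha) (@d2y_right K alpha)) (@piMy K alpha)
    & let beta := @betti K B^c iota deg (My alpha) (@Mydeg K alpha) in
      [/\ beta 0%N 0 1%N, beta 1%N 1 2%N, beta 2%N 2 1%N
        & forall (i : nat) (j : int),
            (i, j) \notin [:: (0%N, 0); (1%N, 1); (2%N, 2)] -> beta i j 0%N]].
Proof.
move=> B deg iota.
have [_ y21 _] := BK_relations alpha.
have y12 : y1 alpha * y2 alpha = - (y2 alpha * y1 alpha) by rewrite y21 opprK.
have deg_y1 : deg 1 (y1 alpha) := BKdeg_gen _ _.
have deg_y2 : deg 1 (y2 alpha) := BKdeg_gen _ _.
have cgB := BK_connected_graded alpha_neq0.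
have cgBc := BKc_connected_graded alpha_neq0.
have left_lin : linear (@piMy_left K alpha : B^o -> My_left alpha).
  exact: quotmod_pi_linear.
have left_surj (m : My_left alpha) : exists z, piMy_left z = m.
  by exists (repr m); exact: quotmod_reprK.
have left_ker (z : B) : piMy_left z = 0 <-> in_By z := quotmod_pi_eq0 _ _.
have right_lin : linear (@piMy K alpha : B^c^o -> My alpha).
  exact: quotmod_pi_linear.
have right_surj (m : My alpha) : exists z, piMy z = m.
  by exists (repr m); exact: quotmod_reprK.
have right_ker (z : B) : piMy z = 0 <-> in_yB z := quotmod_pi_eq0 _ _.
split; split.
- exact: in_yB_eq_in_By.
- apply: (koszul_minimal cgB deg_y1 deg_y2 y21 (BK_y2_right_regular alpha_neq0)
    (BK_y_right_syzygy alpha_neq0) left_lin left_surj _ left_ker) => //.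
- apply: (koszul_betti cgB deg_y1 deg_y2 y21 (BK_y2_right_regular alpha_neq0)
    (BK_y_right_syzygy alpha_neq0) left_lin left_surj _ left_ker) => //.
- apply: (@koszul_minimal K B^c iota deg cgBc _ _ deg_y1 deg_y2 y12
    (BK_y2_regular alpha_neq0) (BK_y_syzygy alpha_neq0)
    _ _ _ right_lin right_surj _ right_ker) => //.
- apply: (@koszul_betti K B^c iota deg cgBc _ _ deg_y1 deg_y2 y12
    (BK_y2_regular alpha_neq0) (BK_y_syzygy alpha_neq0)
    _ _ _ right_lin right_surj _ right_ker) => //.
Qed.
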